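(* Let $M$ be a loopless paving matroid of rank $k\ge1$ on a ground set of size $n$. For $h\ge k$ let $\lambda_h$ be the number of stressed hyperplanes of $M$ of size $h$. Then \[\underline{H}_M(x)=\underline{H}_{U_{k,n}}(x)-\sum_{h\ge k}\lambda_h\bigl(\underline{H}_{U_{k,h+1}}(x)-\underline{H}_{U_{k-1,h}\oplus U_{1,1}}(x)\bigr),\] \[H_M(x)=H_{U_{k,n}}(x)-\sum_{h\ge k}\lambda_h\bigl(H_{U_{k,h+1}}(x)-H_{U_{k-1,h}\oplus U_{1,1}}(x)\bigr).\]
   Context: $U_{a,b}$ is the uniform matroid of rank $a$ on $b$ elements (bases: all $a$-subsets); $\oplus$ is direct sum. A matroid of rank $k$ is paving if every circuit has size at least $k$. A hyperplane is a flat of rank $\mathrm{rk}(M)-1$; a subset $A$ is stressed if both the restriction $M|_A$ and the contraction $M/A$ are uniform matroids; a stressed hyperplane is a hyperplane that is stressed. For a loopless matroid $M$ on $E$ with lattice of flats $\mathcal{L}(M)$: $\underline{\mathrm{CH}}(M)=\mathbb{Q}[x_F: F\in\mathcal{L}(M)\setminus\{\varnothing,E\}]/(I+J)$, $I$ generated by $x_{F_1}x_{F_2}$ for incomparable $F_1,F_2$, $J$ by $\sum_{F\ni i}x_F-\sum_{F\ni j}x_F$ for $i,j\in E$; $\mathrm{CH}(M)=\mathbb{Q}[x_F,y_i: F\in\mathcal{L}(M)\setminus\{E\},\, i\in E]/(I'+J')$, $I'$ generated by $y_i-\sum_{F\not\ni i}x_F$, $J'$ by $x_{F_1}x_{F_2}$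 for incomparable $F_1,F_2$ and $y_ix_F$ for $i\notin F$. Variables of degree $1$; $\underline{H}_M$ and $H_M$ are the Hilbert series $\sum_j\dim_{\mathbb{Q}}(\cdot)^jx^j$. *)

(* Defs.v *)
From HB Require Import structures.
From mathcomp Require Import all_boot all_order all_algebra.
From mathcomp Require Import mpoly.
Set Implicit Arguments. Unset Strict Implicit. Unset Printing Implicit Defensive.
Import Order.TTheory GRing.Theory Num.Theory.
Local Open Scope ring_scope.

Record matroid (E : finType) := Matroid {
  mrank :> {set E} -> nat;
  mrank_le_card : forall X, (mrank X <= #|X|)%N;
  mrank_mono : forall X Y : {set E}, X \subset Y -> (mrank X <= mrank Y)%N;
  mrank_submod : forall X Y : {set E}, (mrank (X :|: Y) + mrank (X :&: Y) <= mrank X + mrank Y)%N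
}.

Section RankNotions.
Variables (E : finType) (r : {set E} -> nat).

Definition flatb (F : {set E}) : bool :=
  [forall x, (x \notin F) ==> (r F < r (x |: F))%N].

Definition loopless : Prop := forall x : E, r [set x] <> 0%N.

Definition indepb (X : {set E}) : bool := r X == #|X|.

Definition circuitb (C : {set E}) : bool :=
  ~~ indepb C && [forall D : {set E}, (D \proper C) ==> indepb D].

Definition paving : Prop := forall C, circuitb C -> (r setT <= #|C|)%N.

Definition hyperplaneb (H : {set E}) : bool :=
  flatb H && (r H == (r setT).-1).

Definition restr_uniformb (A : {set E}) : bool :=
  [forall X : {set E}, (X \subset A) ==> (#|X| <= r A)%N ==> (r X == #|X|)].

(* M/A (ground set E \ A, rank X |-> r (X :|: A) - r A) is uniform:
   every subset of E \ A of size <= rk(M/A) = r E - r A is independent in M/A *)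
Definition contr_uniformb (A : {set E}) : bool :=
  [forall X : {set E}, (X \subset ~: A) ==> (#|X| <= r setT - r A)%N ==>
     (r (X :|: A) - r A == #|X|)%N].

Definition stressedb (A : {set E}) : bool := restr_uniformb A && contr_uniformb A.

Definition num_stressed_hyp (h : nat) : nat :=
  #|[set H : {set E} | hyperplaneb H && stressedb H && (#|H| == h)]|.

End RankNotions.

Definition urank (a b : nat) : {set 'I_b} -> nat := fun X => minn #|X| a.
Arguments urank : clear implicits.

Definition dsum_rank (E1 E2 : finType) (r1 : {set E1} -> nat) (r2 : {set E2} -> nat)
  : {set (E1 + E2)%type} -> nat :=
  fun X => (r1 [set x | inl x \in X] + r2 [set y | inr y \in X])%N.

(* Graded pieces of a quotient of Q[x_0..x_{n-1}] by the ideal        *)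
(* generated by a list G of homogeneous polynomials.                  *)
(* The degree-j piece of the ideal is spanned by the X^m * g (g in G, *)
(* m monomial); its dimension is the rank of the matrix of degree-j   *)
(* coefficients of these products; dim (Q[x]/(G))_j = #{deg-j         *)
(* monomials} - that rank.                                            *)
Definition mvar (n k : nat) : {mpoly rat[n]} :=
  if @insub nat (fun i => i < n)%N 'I_n k is Some i then 'X_i else 0.

Definition deg_monos (n j : nat) : {set 'X_{1..n < j.+1}} :=
  [set m : 'X_{1..n < j.+1} | mdeg (val m) == j].

Definition ideal_mx (n : nat) (G : seq {mpoly rat[n]}) (j : nat) :=
  \matrix_(i < #|{: ('I_(size G) * 'X_{1..n < j.+1})%type}|, c < #|deg_monos n j|)
    (let p := enum_val i in
     ('X_[val p.2] * G`_p.1) @_ (val (enum_val c))).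

Definition quot_dim (n : nat) (G : seq {mpoly rat[n]}) (j : nat) : nat :=
  (#|deg_monos n j| - \rank (ideal_mx G j))%N.

Section Chow.
Variables (E : finType) (r : {set E} -> nat).

Definition incomparable (F1 F2 : {set E}) : bool :=
  ~~ ((F1 \subset F2) || (F2 \subset F1)).

Definition red_flats : seq {set E} :=
  [seq F <- enum {: {set E}} | flatb r F && (F != set0) && (F != setT)].

Definition red_chow_gens : seq {mpoly rat[size red_flats]} :=
  let fl := red_flats in
  let x F := mvar (size fl) (index F fl) in
  [seq x p.1 * x p.2 | p <- [seq (F1, F2) | F1 <- fl, F2 <- fl]
                     & incomparable p.1 p.2] ++
  [seq (\sum_(F <- fl | p.1 \in F) x F) - (\sum_(F <- fl | p.2 \in F) x F)
     | p <- [seq (i, j) | i <- enum E, j <- enum E]].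

Definition red_hilb (j : nat) : nat := quot_dim red_chow_gens j.

Definition aug_flats : seq {set E} :=
  [seq F <- enum {: {set E}} | flatb r F && (F != setT)].

Definition aug_chow_gens : seq {mpoly rat[size aug_flats + #|E|]} :=
  let fl := aug_flats in
  let N := (size fl + #|E|)%N in
  let x F := mvar N (index F fl) in
  let y i := mvar N (size fl + enum_rank i) in
  [seq y i - \sum_(F <- fl | i \notin F) x F | i <- enum E] ++
  [seq x p.1 * x p.2 | p <- [seq (F1, F2) | F1 <- fl, F2 <- fl]
                     & incomparable p.1 p.2] ++
  [seq y p.1 * x p.2 | p <- [seq (i, F) | i <- enum E, F <- fl] & p.1 \notin (p.2 : {set E})].

Definition aug_hilb (j : nat) : nat := quot_dim aug_chow_gens j.

End Chow.

(* Main.v *)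
(* Both Chow rings are instances of one ring attached to a finite semimodular lattice with bottom
   b and top E: generators x_F for F > b, with x_b = 1, and relations x_F x_G = 0 for F, G
   incomparable and x_F * sum_(G >= H) x_G = 0 for H covering F.  For the reduced ring the lattice
   is that of flats; for the augmented ring a new bottom is added below the empty flat.  In both
   cases x_E is eliminated by a linear relation.

   A basis is given by the Feichtner--Yuzvinsky monomials x_F1^a1 ... x_Fm^am on chains
   b = F0 < F1 < ... < Fm <= E with 0 < ai < rk Fi - rk F(i-1).  They span because
   x_F (sum_(G >= H) x_G)^(rk H - rk F) = 0 for F < H.  They are independent because of an
   explicit degree functional, given on chain monomials by products of coefficients of reduced
   characteristic polynomials of intervals; it kills the relations by Weisner's theorem, and its
   pairing between a monomial and the complementary ones is triangular.

   For a paving matroid of rank k on n elements, a monomial involves at most one hyperplane H.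
   The number of those involving none depends only on n and k, and the number of those involving H
   only on |H| and k.  As every (k-1)-subset lies in exactly one hyperplane,
   sum_H C(|H|, k-1) = C(n, k-1), so the Hilbert function is B(n) + sum_(h >= k) lambda_h D(h) with
   B and D depending only on k.  U_(k,n) has no hyperplane of size at least k, while
   U_(k-1,h) + U_(1,1) has exactly one, of size h. *)

Require Import Defs.
From HB Require Import structures.
From mathcomp Require Import all_boot all_order all_algebra.
From mathcomp Require Import mpoly.
From mathcomp Require Import zify ring.
Set Implicit Arguments. Unset Strict Implicit. Unset Printing Implicit Defensive.
Import Order.TTheory GRing.Theory Num.Theory.
Local Open Scope ring_scope.

(** The Hilbert functions are defined through matrix ranks, so no quotient ring is formed: ideals
    are tested by linear functionals. A vector in the kernel of [ideal_mx] is a functional on degree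
    j that kills the relations. It is zero as soon as it kills the Feichtner--Yuzvinsky monomials,
    which bounds the dimension from above; the degree pairing supplies enough such functionals to
    bound it from below.

    Putting x_b = 1 turns the linear relations into the case F = b of the covering relations, so the
    degree has to satisfy only one family of sums. Its values are forced: on an interval of rank d,
    with alpha the negative of the top variable and beta the sum of all variables, alpha^(d-1-e)
    beta^e must have degree [rho e]. The covering relation then rests on two facts: the sum of
    |mu(x, y)| over the y of rank e + 1 above an atom is [rho e] for every atom, and Pascal's rule.

    Semimodularity is stated for an arbitrary common lower bound, so that meets need not be
    constructed. Adjoining a bottom raises all ranks by one, which is the origin of the shift [s] in
    the counts. *)

Record smlattice (T : finType) := SMLattice {
  sle : rel T;
  sjoin : T -> T -> T;
  srk : T -> nat;
  sbot : T;
  stop : T;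
  sle_refl : reflexive sle;
  sle_anti : antisymmetric sle;
  sle_trans : transitive sle;
  sle_bot : forall x, sle sbot x;
  sle_top : forall x, sle x stop;
  sle_join : forall x y z, sle (sjoin x y) z = sle x z && sle y z;
  srk_bot : srk sbot = 0%N;
  srk_mono : forall x y, sle x y -> x != y -> (srk x < srk y)%N;
  srk_cover : forall x y, sle x y -> x != y ->
    exists z, [/\ sle x z, sle z y & srk z = (srk x).+1];
  srk_semimod : forall k x y, sle k x -> sle k y ->
    (srk (sjoin x y) + srk k <= srk x + srk y)%N
}.

(** * Möbius function, Weisner's theorem and reduced characteristic coefficients *)

Section Mobius.
Variables (T : finType) (L : smlattice T).
Implicit Types x y z a w : T.

Local Notation "x <=L y" := (sle L x y) (at level 70).
Definition slt x y := (x != y) && (x <=L y).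
Local Notation "x <L y" := (slt x y) (at level 70).
Local Notation rk := (srk L).
Local Notation "x \v y" := (sjoin L x y) (at level 50).
Local Notation d x y := (rk y - rk x)%N.

Lemma sltW x y : x <L y -> x <=L y. Proof. by case/andP. Qed.

Lemma slt_rk x y : x <L y -> (rk x < rk y)%N.
Proof. by case/andP=> n l; apply: srk_mono. Qed.

Lemma sle_rk x y : x <=L y -> (rk x <= rk y)%N.
Proof.
by move=> l; have [->//|n] := eqVneq x y; apply/ltnW/slt_rk; rewrite /slt n.
Qed.

Lemma sle_lt_trans y x z : x <=L y -> y <L z -> x <L z.
Proof.
move=> lxy /[dup] /slt_rk r /sltW lyz; rewrite /slt (sle_trans lxy lyz) andbT.
by apply: contraTneq r => <-; rewrite -leqNgt sle_rk.
Qed.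

Lemma slt_le_trans y x z : x <L y -> y <=L z -> x <L z.
Proof.
move=> /[dup] /slt_rk r /sltW lxy lyz; rewrite /slt (sle_trans lxy lyz) andbT.
by apply: contraTneq r => ->; rewrite -leqNgt sle_rk.
Qed.

Lemma slt_trans y x z : x <L y -> y <L z -> x <L z.
Proof. by move=> /sltW; apply: sle_lt_trans. Qed.

Lemma sltxx x : (x <L x) = false. Proof. by rewrite /slt eqxx. Qed.

Lemma sltNge x y : x <L y -> ~~ (y <=L x).
Proof. by move=> h; apply/negP => /(slt_le_trans h); rewrite sltxx. Qed.

Lemma sle_eqVlt x y : (x <=L y) = (x == y) || (x <L y).
Proof. by rewrite /slt; case: eqVneq => // ->; rewrite sle_refl. Qed.

Lemma sle_eq_rk x y : x <=L y -> (rk y <= rk x)%N -> x = y.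
Proof.
rewrite sle_eqVlt => /orP[/eqP//|/slt_rk]; by rewrite ltnNge => /negPf ->.
Qed.

Lemma sjoinl x y : x <=L x \v y.
Proof. by have := sle_refl L (x \v y); rewrite sle_join => /andP[]. Qed.

Lemma sjoinr x y : y <=L x \v y.
Proof. by have := sle_refl L (x \v y); rewrite sle_join => /andP[]. Qed.

Lemma sjoin_eql x y : y <=L x -> x \v y = x.
Proof.
by move=> l; apply: (@sle_anti _ L); rewrite sle_join sle_refl l sjoinl.
Qed.

Definition covers x a := (x <=L a) && (rk a == (rk x).+1).

Lemma covers_lt x a : covers x a -> x <L a.
Proof.
by case/andP=> l /eqP e; rewrite /slt l andbT; apply: contra_eqN e => /eqP->; lia.
Qed.

(** Semimodularity over the lower bound [x] lets the rank grow by at most one, and it grows because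
    [a] is not below [y]. *)
Lemma rk_join_cover x a y : covers x a -> x <=L y -> ~~ (a <=L y) ->
  covers y (y \v a).
Proof.
move=> /andP[la /eqP ra] ly na; rewrite /covers sjoinl /=.
have := srk_semimod ly la; have : y <L y \v a; last by move/slt_rk; lia.
by rewrite /slt sjoinl andbT; apply: contraNneq na => ->; apply: sjoinr.
Qed.

(** The recursion of the Möbius function descends along the order, not along a structure, so it runs
    on fuel; by [mobE] the rank of [y] is enough. *)
Fixpoint mob n x y : rat :=
  if x == y then 1 else
  if n is n'.+1 then - \sum_(z | (x <=L z) && (z <L y)) mob n' x z else 0.

Definition mu x y := mob (rk y) x y.

Lemma mobE n x y : (rk y <= n)%N -> mob n x y = mu x y.
Proof.
rewrite /mu; have [m] := ubnP (rk y); elim: m n y => // m IH n y ltm len.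
case: n len => [|n] len; first by have ->: rk y = 0%N by lia.
case E: (rk y) => [|p] /=; case: eqVneq => // nxy.
  rewrite big_pred0 ?oppr0 // => z; apply/negP=> /andP[_ /slt_rk]; lia.
congr (- _); apply: eq_bigr => z /andP[_ /slt_rk lt].
rewrite [LHS]IH; try lia; rewrite [RHS]IH //; lia.
Qed.

Lemma muxx x : mu x x = 1.
Proof. by rewrite /mu; case: (rk x) => [|n] /=; rewrite eqxx. Qed.

Lemma mu_sum x y : x <L y -> \sum_(z | (x <=L z) && (z <=L y)) mu x z = 0.
Proof.
move=> lt; rewrite (bigD1 y) ?sle_refl ?(sltW lt) //=.
rewrite -(@mobE (rk y)) //; have := slt_rk lt; case E: (rk y) => [//|n] _ /=.
have /andP[/negPf-> _] := lt; apply/eqP; rewrite addrC subr_eq0; apply/eqP.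
apply: eq_big => [z|z /andP[/andP[_ l] nz]].
  by rewrite -andbA; congr andb; rewrite andbC.
by rewrite mobE //; have/slt_rk: z <L y by [rewrite /slt l nz]; lia.
Qed.

(** The vanishing sum of mu over [x, z] is sorted by the value z' of y v a. By induction the parts
    with z' < z vanish, hence so does the part z' = z. *)
Lemma weisner x a z : x <L a -> a <=L z ->
  \sum_(y | (x <=L y) && (y \v a == z)) mu x y = 0.
Proof.
move=> lxa; have [m] := ubnP (rk z); elim: m z => // m IH z ltm laz.
have := mu_sum (slt_le_trans lxa laz).
rewrite (partition_big (fun y => y \v a) (fun z' => (a <=L z') && (z' <=L z))) /=;
  last by move=> y /andP[_ l]; rewrite sjoinr sle_join l laz.
rewrite (bigD1 z) ?laz ?sle_refl //= [X in _ + X]big1 ?addr0 => [|z' /andP[/andP[l1 l2] n]].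
  move=> h; rewrite -[RHS]h; apply: eq_bigl => y; rewrite -andbA; congr andb.
  by case: eqP => [<-|]; rewrite ?andbF ?andbT ?sjoinl.
rewrite -[RHS](IH z') //.
  apply: eq_bigl => y; rewrite -andbA; congr andb.
  case: eqP => [e|]; rewrite ?andbF // andbT.
  by apply: sle_trans l2; rewrite -e sjoinl.
by have/slt_rk: z' <L z by [rewrite /slt l2 n]; lia.
Qed.

(** The absolute value of mu, whose sign alternates with the rank in a semimodular lattice. *)
Definition tau x y : rat := (-1) ^+ d x y * mu x y.

Lemma tauxx x : tau x x = 1. Proof. by rewrite /tau subnn muxx mulr1. Qed.

(** Weisner's theorem with the term y = z isolated: every other y misses [a] and is covered by [z],
    so the change of parity absorbs the minus sign. *)
Lemma tau_rec x a z : covers x a -> a <=L z ->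
  tau x z = \sum_(y | [&& x <=L y, ~~ (a <=L y) & y \v a == z]) tau x y.
Proof.
move=> ca laz; have lxa := covers_lt ca; have := weisner lxa laz.
rewrite (bigD1 z) /=; last by rewrite (sltW (slt_le_trans lxa laz)) sjoin_eql ?eqxx.
move/eqP; rewrite addr_eq0 /tau => /eqP->.
rewrite mulrN -mulNr mulr_sumr; apply: eq_big => [y|y].
  rewrite -andbA; congr andb => /=; case: (boolP (a <=L y)) => la /=.
    by rewrite sjoin_eql // andbN.
  case: eqP => //= e; apply: contraNneq la => ey.
  by have := sjoinr y a; rewrite e -ey.
case/andP=> /andP[lxy /eqP e] ne; congr (_ * _).
have na : ~~ (a <=L y) by apply: contra_neqN ne => /sjoin_eql; rewrite e => ->.
have /andP[_ /eqP] := rk_join_cover ca lxy na; rewrite e => ->.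
by rewrite subSn ?sle_rk // exprS mulN1r opprK.
Qed.

(** The unsigned Whitney number of the first kind of [x, z]. *)
Definition whitney e x z : rat :=
  \sum_(y | [&& x <=L y, y <=L z & rk y == (rk x + e)%N]) tau x y.

(* The unsigned coefficient of index [e] of the reduced characteristic polynomial of [x, z]:
   whitney e = rho e + rho (e - 1). *)
Fixpoint rho e x z : rat :=
  if e is e'.+1 then whitney e'.+1 x z - rho e' x z else 1.

(** By induction, subtracting [rho e] from the Whitney number of index e + 1 leaves the y of that
    rank that miss the atom [a]. The map y -> y v a sends them to elements one rank higher above
    [a], and [tau_rec] adds up the fibres. In particular the right side does not depend on [a]. *)
Lemma rhoE x a z e : covers x a -> a <=L z ->
  rho e x z = \sum_(y | [&& a <=L y, y <=L z & rk y == (rk x + e.+1)%N]) tau x y.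
Proof.
move=> ca laz; have lxa := covers_lt ca; have /andP[_ /eqP ra] := ca.
elim: e => [|e IH] /=.
  rewrite (big_pred1 a) => [|y].
    rewrite (tau_rec ca) ?sle_refl // (big_pred1 x) ?tauxx // => y.
    apply/and3P/eqP => [[lxy na /eqP e]|->].
      have /andP[_ /eqP] := rk_join_cover ca lxy na; rewrite e => r.
      by apply/esym/sle_eq_rk => //; lia.
    rewrite sle_refl sltNge //; split=> //; apply/eqP/(@sle_anti _ L).
    by rewrite sle_join sle_refl sjoinr (sltW lxa).
  apply/and3P/eqP => [[lay _ /eqP r]|->]; first by apply/esym/sle_eq_rk => //; lia.
  by rewrite sle_refl laz ra addn1.
transitivity (\sum_(y | [&& x <=L y, ~~ (a <=L y), y <=L z & rk y == (rk x + e.+1)%N]) tau x y).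
  rewrite IH /whitney (bigID (fun y => a <=L y)) /=.
  rewrite [X in X + _ - _](_ : _ =
      \sum_(y | [&& a <=L y, y <=L z & rk y == (rk x + e.+1)%N]) tau x y).
    rewrite addrAC subrr add0r; apply: eq_bigl => y.
    by rewrite andbC; case: (x <=L y); case: (a <=L y).
  apply: eq_bigl => y; case: (boolP (a <=L y)) => la; rewrite ?andbF ?andbT //.
  by rewrite (sle_trans (sltW lxa) la).
rewrite (partition_big (fun y => y \v a)
   (fun y => [&& a <=L y, y <=L z & rk y == (rk x + e.+2)%N])) /=; last first.
  move=> y /and4P[lxy na lyz /eqP r]; have /andP[_ /eqP ->] := rk_join_cover ca lxy na.
  rewrite sjoinr sle_join lyz laz r /=; apply/eqP; lia.
apply: eq_bigr => z' /and3P[laz' lz' /eqP r]; rewrite (tau_rec ca laz').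
apply: eq_bigl => y; case: (boolP (x <=L y)) => //= lxy; case: (boolP (a <=L y)) => //= na.
case: (_ =P z') => [ez|_]; rewrite ?andbF ?andbT //.
have /andP[_ /eqP] := rk_join_cover ca lxy na; rewrite ez r => e'.
have -> : y <=L z by apply: sle_trans lz'; rewrite -ez sjoinl.
by apply/eqP; lia.
Qed.

Lemma rho_sum_lt x z a e : covers x a -> a <=L z ->
  \sum_(y | [&& a <=L y, y <L z & rk y == (rk x + e.+1)%N]) tau x y =
  rho e x z - (if rk z == (rk x + e.+1)%N then tau x z else 0).
Proof.
move=> ca laz; rewrite (rhoE _ ca laz); case: ifP => h.
  rewrite [in RHS](bigD1 z) ?laz ?sle_refl ?h //= addrAC subrr add0r.
  by apply: eq_bigl => y; rewrite /slt; case: eqP; rewrite ?andbF ?andbT.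
rewrite subr0; apply: eq_bigl => y; rewrite /slt; case: eqP => [->|//].
by rewrite h ?andbF.
Qed.

(** Only [z] itself has the top rank, so the sum over the elements above an atom is one term. *)
Lemma rho_top x z e : x <L z -> rk z = (rk x + e.+1)%N -> rho e x z = tau x z.
Proof.
move=> /[dup] lt /andP[n l] r; have [a [l1 l2 ra]] := srk_cover l n.
have ca : covers x a by rewrite /covers l1 ra eqxx.
apply/eqP; rewrite -subr_eq0; have := rho_sum_lt e ca l2; rewrite r eqxx => <-.
rewrite big_pred0 // => y; apply/negP => /and3P[_ /slt_rk + /eqP]; lia.
Qed.

Lemma whitney_lt x z e :
  x <L z -> \sum_(y | [&& x <L y, y <L z & rk y == (rk x + e.+1)%N]) tau x y =
  rho e.+1 x z + rho e x z - (if rk z == (rk x + e.+1)%N then tau x z else 0).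
Proof.
move=> lt; rewrite /= subrK /whitney.
have E y : rk y == (rk x + e.+1)%N -> (x <=L y) = (x <L y).
  by move=> /eqP r; rewrite sle_eqVlt; case: eqP => // xy; move: r; rewrite -xy; lia.
case: ifP => h.
  rewrite [in RHS](bigD1 z) ?(sltW lt) ?sle_refl ?h //= addrAC subrr add0r.
  apply: eq_bigl => y; case: (boolP (rk y == _)) => [r|]; last by rewrite !andbF.
  by rewrite !andbT E // -andbA; congr andb; rewrite andbC.
rewrite subr0; apply: eq_bigl => y; case: (boolP (rk y == _)) => [r|]; last by rewrite !andbF.
rewrite !andbT E //; have [ey|n] := eqVneq y z; first by move: h; rewrite -ey r.
by congr andb; rewrite /slt n.
Qed.

End Mobius.

(** * The degree of a chain monomial *)

Arguments rho : simpl never.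

Section Degree.
Variables (T : finType) (L : smlattice T).
Implicit Types (F G H K : T) (l : seq (T * nat)).

Local Notation "x <=L y" := (sle L x y) (at level 70).
Local Notation "x <L y" := (slt L x y) (at level 70).
Local Notation rk := (srk L).
Local Notation "x \v y" := (sjoin L x y) (at level 50).
Local Notation d x y := (rk y - rk x)%N.
Local Notation tau := (tau L).
Local Notation rho := (rho L).
Local Notation E := (stop L).

(** A [G] incomparable to a block is carried past it; the position does not matter, since [ev]
    vanishes on lists that are not chains. *)
Fixpoint ins G l :=
  if l is (K, c) :: l' then
    if G <L K then (G, 1%N) :: l
    else if G == K then (K, c.+1) :: l'
    else (K, c) :: ins G l'
  else [:: (G, 1%N)].

(** The share of the lower factor [F, K] in beta^e x_K^c. In (-alpha - beta)^(c-1), alpha lives on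
    [F, K] and beta on [K, E]; the top degree d F K - 1 of the lower factor forces beta to be chosen
    e + c - d F K times, and alpha^(d F K - 1 - e) beta^e has degree [rho e F K]. *)
Definition wt F e K c : rat :=
  if (F <L K) && (d F K <= e + c)%N
  then (-1) ^+ c.-1 * rho e F K * 'C(c.-1, e + c - d F K)%:R else 0.

(* [ev b F e l] is the degree of beta^e * x_K1^c1 * x_K2^c2 * ... * x_E^b in the Chow ring of the
   interval [F, E], where l = [:: (K1, c1); (K2, c2); ...]: multiplying by x_K restricts to
   [F, K] x [K, E], where x_K acts as -alpha - beta. *)
Fixpoint ev b F e l : rat :=
  if l is (K, c) :: l' then wt F e K c * ev b K (e + c - d F K)%N l'
  else if (e + b).+1 == d F E then (-1) ^+ b * rho e F E else 0.

Local Notation keys l := (map (@fst T nat) l).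

Lemma mem_keys_ins G l K : (K \in keys (ins G l)) = (K == G) || (K \in keys l).
Proof.
elim: l => [|[K' c] l IH] //=; case: ifP => //= _; case: eqP => [->|] /=.
  by rewrite inE; case: eqP.
by rewrite !inE IH orbCA.
Qed.

Lemma ev_key0 b F e l K : K \in keys l -> ~~ (F <L K) -> ev b F e l = 0.
Proof.
elim: l F e => [//|[K' c] l IH] F e /=; rewrite inE /wt => /orP[/eqP->|kl] nFK.
  by rewrite (negPf nFK) mul0r.
case: ifP => [/andP[lt _]|]; last by rewrite mul0r.
by rewrite IH ?mulr0 //; apply: contra nFK; apply: slt_trans.
Qed.

Lemma ev_ins0 b F e l G : ~~ (F <L G) -> ev b F e (ins G l) = 0.
Proof. by apply: ev_key0; rewrite mem_keys_ins eqxx. Qed.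

Lemma ev_top0 b e l : ev b E e l = 0.
Proof.
case: l => [|[K c] l]; first by rewrite /= subnn.
apply: (@ev_key0 _ _ _ _ K); rewrite ?mem_head //=; apply/negP => /sltNge.
by rewrite sle_top.
Qed.

(** A single factor x_G carries the binomial 'C(0, _), so it counts only in rank e + 1 above [F]. A
    block at [E] evaluates to 0; the variable x_E enters through the term with b.+1. *)
Lemma ev_nil_sum b F e (P : pred T) :
  \sum_(G | P G) ev b F e [:: (G, 1%N)] + ev b.+1 F e [::] =
  if (e + b).+2 == d F E then (-1) ^+ b *
    (\sum_(G | [&& P G, F <L G, G <L E & rk G == (rk F + e.+1)%N]) tau F G - rho e F E)
  else 0.
Proof.
have -> : \sum_(G | P G) ev b F e [:: (G, 1%N)] =
   \sum_(G | [&& P G, F <L G, G <L E & rk G == (rk F + e.+1)%N])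
     if (e + b).+2 == d F E then (-1) ^+ b * tau F G else 0.
  rewrite [RHS]big_mkcondr [RHS]big_mkcond [LHS]big_mkcond /=.
  apply: eq_bigr => G _; case: (P G) => //=; rewrite /wt.
  case: (boolP (F <L G)) => [lt|] /=; last by rewrite mul0r.
  have := slt_rk lt => r.
  case: (boolP (rk G == (rk F + e.+1)%N)) => [/eqP rG|nr]; last first.
    rewrite andbF; case: ifP => [le|]; last by rewrite mul0r.
    by rewrite bin0n; case: eqP => [h0|_]; [exfalso; lia | rewrite mulr0 mul0r].
  have := sle_top L G; rewrite sle_eqVlt => /orP[/eqP->|ltE].
    by rewrite sltxx subnn /= mulr0.
  rewrite ltE /=; have -> : (d F G <= e + 1)%N by lia.
  have -> : (e + 1 - d F G = 0)%N by lia.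
  rewrite bin0 expr0 mul1r !mulr1 (rho_top lt rG) add0n.
  have := slt_rk ltE; have -> : (b.+1 == d G E) = ((e + b).+2 == d F E) by lia.
  by case: ifP => _; rewrite ?mulr0 // mulrC.
rewrite /= (addnS e b); case: ifP => _; last by rewrite big1 ?addr0.
by rewrite -mulr_sumr exprS; ring.
Qed.

(** The computation common to the beta and the alpha relation. A new factor falls before [K], on [K]
    or behind [K], and these cases give the three summands of the bracket; behind [K], the
    hypothesis turns the sum together with x_E into one more beta on [K, E]. *)
Lemma ev_cons_sum b F e K c l (P : pred T) :
  (forall e, \sum_G ev b K e (ins G l) + ev b.+1 K e l = ev b K e.+1 l) ->
  (forall G, K <=L G -> P G) -> F <L K ->
  let q := (e + c.+2 - d F K)%N in
  \sum_(G | P G) ev b F e (ins G ((K, c.+1) :: l)) + ev b.+1 F e ((K, c.+1) :: l) =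
  if (d F K <= e + c.+2)%N then (-1) ^+ c * ev b K q l *
    (\sum_(G | [&& P G, F <L G, G <L K & rk G == (rk F + e.+1)%N]) tau F G * 'C(c, q)%:R
     - rho e F K * 'C(c.+1, q)%:R
     + if (d F K <= e + c.+1)%N then rho e F K * 'C(c, q.-1)%:R else 0) else 0.
Proof.
move=> IH PK ltFK q; have rFK := slt_rk ltFK.
rewrite (bigD1 K) ?PK ?sle_refl //= (bigID (fun G => G <L K)) /= sltxx eqxx.
rewrite (eq_bigr (fun G => wt F e G 1 * (wt G (e + 1 - d F G) K c.+1 *
   ev b K (e + 1 - d F G + c.+1 - d G K) l))); last by move=> G /andP[_ ->].
(* The [G] excluded by the filter are not strictly above [K], so by [ev_ins0] the sum may run over
   all [G]. *)
have -> : \sum_(G | P G && (G != K) && ~~ (G <L K))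
   ev b F e (if G <L K then [:: (G, 1%N), (K, c.+1) & l]
     else if G == K then (K, c.+2) :: l else (K, c.+1) :: ins G l) =
   wt F e K c.+1 * \sum_G ev b K (e + c.+1 - d F K) (ins G l).
  rewrite mulr_sumr [RHS](bigID (fun G => P G && (G != K) && ~~ (G <L K))) /=.
  rewrite [X in _ = _ + X]big1 ?addr0 => [|G].
    by apply: eq_bigr => G /andP[/andP[_ /negPf->] /negPf->].
  move=> h; rewrite ev_ins0 ?mulr0 //; apply: contra h => lt; rewrite (PK _ (sltW lt)) /=.
  rewrite (_ : G != K) /=; last by apply: contraTneq lt => ->; rewrite sltxx.
  by apply/negP => /sltNge; rewrite (sltW lt).
rewrite -!addrA -mulrDr IH.
have -> : \sum_(G | P G && (G != K) && (G <L K)) wt F e G 1 *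
   (wt G (e + 1 - d F G) K c.+1 * ev b K (e + 1 - d F G + c.+1 - d G K) l) =
   \sum_(G | [&& P G, F <L G, G <L K & rk G == (rk F + e.+1)%N]) tau F G *
     (if (d F K <= e + c.+2)%N then (-1) ^+ c * 'C(c, q)%:R * ev b K q l else 0).
  rewrite [RHS]big_mkcondr [RHS]big_mkcond [LHS]big_mkcond /=.
  apply: eq_bigr => G _; case: (P G) => //=; rewrite /wt.
  case: (boolP (F <L G)) => [lt|] /=; last by rewrite mul0r if_same.
  have rFG := slt_rk lt; case: (boolP (G <L K)) => [ltG|]; last by rewrite ?andbF.
  have -> : G != K by case/andP: ltG.
  have rGK := slt_rk ltG.
  case: (boolP (rk G == (rk F + e.+1)%N)) => [/eqP rG|nr] /=; last first.
    case: ifP => [le|]; last by rewrite mul0r.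
    by rewrite bin0n; case: eqP => [h0|_]; [exfalso; lia | rewrite mulr0 mul0r].
  have -> : (d F G <= e + 1)%N by lia.
  have -> : (e + 1 - d F G = 0)%N by lia.
  rewrite bin0 expr0 mul1r !mulr1 (rho_top lt rG) add0n /=.
  have -> : (c.+1 - d G K = q)%N by rewrite /q; lia.
  have -> : (d G K <= c.+1)%N = (d F K <= e + c.+2)%N by lia.
  by case: ifP => _; rewrite ?mul0r ?mulr0 ?mulr1.
rewrite /= /wt ltFK /= -/q -!mulr_suml; case: (leqP (d F K) (e + c.+2)) => h; last first.
  have -> : (d F K <= e + c.+1)%N = false by lia.
  by rewrite !(mulr0, mul0r, addr0).
case: ifP => h'.
  have -> : (e + c.+1 - d F K).+1 = q by rewrite /q; lia.
  have -> : (e + c.+1 - d F K)%N = q.-1 by rewrite /q; lia.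
  by rewrite exprS; ring.
by rewrite mul0r exprS; ring.
Qed.

Definition exps_pos l := all (fun p : T * nat => (0 < p.2)%N) l.

(* The sum of all x_G with G > F, including x_E, is beta. *)
Lemma ev_beta b F e l : exps_pos l ->
  \sum_G ev b F e (ins G l) + ev b.+1 F e l = ev b F e.+1 l.
Proof.
elim: l F e => [|[K [//|c]] l IH] F e; first move=> _.
  have := sle_top L F; rewrite sle_eqVlt => /orP[/eqP->|lt].
    rewrite big1 => [|G _]; first by rewrite /= subnn addr0.
    by rewrite ev_ins0 //; apply/negP => /sltNge; rewrite sle_top.
  rewrite ev_nil_sum /= whitney_lt // addSn; case: eqP => // h; congr (_ * _).
  case: eqP => [|_]; last by ring.
  by have := slt_rk lt; lia.
move=> /andP[_ /IH {}IH]; have [lt|nlt] := boolP (F <L K); last first.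
  rewrite big1 ?add0r => [|G _]; first by rewrite /= /wt (negPf nlt) !mul0r.
  apply: (ev_key0 _ _ _ nlt); rewrite (mem_keys_ins G ((K, c.+1) :: l)) /= inE eqxx.
  by rewrite orbT.
have := @ev_cons_sum b F e K c l predT (fun e => IH K e) (fun _ _ => isT) lt.
rewrite /= => ->; rewrite -mulr_suml whitney_lt // /wt lt /= addSnnS.
case: ifP => h; last by rewrite mul0r.
set q := (e + c.+2 - d F K)%N; have rFK := slt_rk lt.
have Dq : (d F K + q = e + c.+2)%N by rewrite /q; lia.
(* [whitney_lt] contributes rho e.+1 + rho e, and Pascal's rule cancels rho e. The correction for rk
   K = rk F + e.+1 is harmless, since then q = c.+1 and 'C(c, q) = 0. *)
transitivity ((-1) ^+ c * ev b K q l * (rho e.+1 F K * 'C(c, q)%:R)); last by ring.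
congr (_ * _).
case: (posnP q) => [q0|qp].
  have -> : (d F K <= e + c.+1)%N = false by lia.
  by rewrite q0 !bin0; case: eqP => [h0|_]; [exfalso; lia | ring].
have -> : (d F K <= e + c.+1)%N by lia.
case: q qp Dq => // q _ Dq; rewrite binS natrD /=.
case: eqP => [rK|_]; last by ring.
have -> : q = c by lia.
by rewrite bin_small //; ring.
Qed.

(** As the first block, if any, lies above [H], the sum of tau over the [G] above the atom [H] is
    [rho e] by [rho_sum_lt]; Pascal's rule then makes the bracket of [ev_cons_sum] zero. *)
Lemma ev_alpha_head b F e l H : exps_pos l -> covers L F H ->
  (forall K, ohead (keys l) = Some K -> H <=L K) ->
  \sum_(G | H <=L G) ev b F e (ins G l) + ev b.+1 F e l = 0.
Proof.
move=> pl cFH hl; have lFH := covers_lt cFH.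
have E' Z : \sum_(G | [&& H <=L G, F <L G, G <L Z & rk G == (rk F + e.+1)%N]) tau F G =
   \sum_(G | [&& H <=L G, G <L Z & rk G == (rk F + e.+1)%N]) tau F G.
  apply: eq_bigl => G; case: (boolP (H <=L G)) => //= lG.
  by rewrite (slt_le_trans lFH lG).
case: l pl hl => [_ _|[K [//|c]] l /= pl hl].
  rewrite ev_nil_sum E' (rho_sum_lt _ cFH) ?sle_top //.
  case: eqP => // h; case: eqP => [|_]; last by ring.
  by have := slt_rk (slt_le_trans lFH (sle_top L H)); lia.
have lHK : H <=L K by apply: hl.
have lt := slt_le_trans lFH lHK.
have := @ev_cons_sum b F e K c l [pred G | H <=L G] (fun e => ev_beta b K e pl)
  (fun G => @sle_trans _ L K H G lHK) lt.
rewrite /= => ->; rewrite -mulr_suml E' (rho_sum_lt _ cFH) //.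
case: ifP => // h.
set q := (e + c.+2 - d F K)%N; have rFK := slt_rk lt.
have Dq : (d F K + q = e + c.+2)%N by rewrite /q; lia.
apply/eqP; rewrite mulf_eq0; apply/orP; right; apply/eqP.
case: (posnP q) => [q0|qp].
  have -> : (d F K <= e + c.+1)%N = false by lia.
  by rewrite q0 !bin0; case: eqP => [h0|_]; [exfalso; lia | ring].
have -> : (d F K <= e + c.+1)%N by lia.
case: q qp Dq => // q _ Dq; rewrite binS natrD /=.
case: eqP => [rK|_]; last by ring.
have -> : q = c by lia.
by rewrite bin_small //; ring.
Qed.

(** Blocks up to [F] are peeled off. If [F] is the start and the first block [K] is not above [H],
    then K v H covers [K] by semimodularity and the relation passes to this cover: a contributing
    [G] lies above both [K] and [H]. *)
Lemma ev_alpha b F0 e l F H : exps_pos l -> F = F0 \/ F \in keys l -> covers L F H ->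
  \sum_(G | H <=L G) ev b F0 e (ins G l) + ev b.+1 F0 e l = 0.
Proof.
elim: l F0 e F H => [|[K c] l IH] F0 e F H pl hF cFH.
  by case: hF => // hF; rewrite -hF; apply: ev_alpha_head.
have lFH := covers_lt cFH.
have [lt|nlt] := boolP (F0 <L K); last first.
  rewrite big1 ?add0r => [|G _]; first by rewrite /= /wt (negPf nlt) !mul0r.
  by apply: (ev_key0 _ _ _ nlt); rewrite mem_keys_ins /= inE eqxx orbT.
have step F' H' : F' = K \/ F' \in keys l -> covers L F' H' ->
    (forall G, H <=L G -> K <L G -> H' <=L G) -> (forall G, H' <=L G -> H <=L G) ->
    (forall G, H <=L G -> ~~ (G <=L K)) ->
  \sum_(G | H <=L G) ev b F0 e (ins G ((K, c) :: l)) + ev b.+1 F0 e ((K, c) :: l) = 0.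
  move=> hF' cF' h1 h2 h3; case/andP: pl => _ /IH {}IH.
  rewrite (eq_bigr (fun G => wt F0 e K c * ev b K (e + c - d F0 K) (ins G l))); last first.
    move=> G /h3 /=; rewrite sle_eqVlt negb_or => /andP[/negPf-> /negPf->] //.
  rewrite -mulr_sumr /= -mulrDr.
  rewrite [X in _ * (X + _)](_ : _ = \sum_(G | H' <=L G) ev b K (e + c - d F0 K) (ins G l)).
    by rewrite (IH _ _ _ _ hF' cF') mulr0.
  rewrite (bigID (fun G => H' <=L G)) /= [X in _ + X]big1 ?addr0.
    by apply: eq_bigl => G; apply/andP/idP => [[]//|h]; rewrite h h2.
  move=> G /andP[hG nG]; rewrite ev_ins0 //; apply: contra nG; exact: h1.
case: hF => [eF|].
  have [lHK|nHK] := boolP (H <=L K).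
    by rewrite -eF; apply: ev_alpha_head => //= _ [<-].
  have cK : covers L K (K \v H).
    by apply: (rk_join_cover cFH) => //; rewrite eF (sltW lt).
  apply: (step K (K \v H)) => //; first by left.
  - by move=> G hG /sltW lKG; rewrite sle_join lKG.
  - by move=> G; rewrite sle_join => /andP[].
  - by move=> G hG; apply: contra nHK; apply: sle_trans.
rewrite inE => /orP[/eqP eF|Fl].
  apply: (step F H) => //; first by left.
  move=> G hG; apply/negP => l2; have := slt_le_trans lFH (sle_trans hG l2).
  by rewrite eF sltxx.
have [ltK|nltK] := boolP (K <L F).
  apply: (step F H) => //; first by right.
  move=> G hG; apply/negP => l2; have := slt_trans ltK (slt_le_trans lFH (sle_trans hG l2)).
  by rewrite sltxx.
have nF q b' l' : F \in keys l' -> ev b' K q l' = 0.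
  by move=> hl; apply: (ev_key0 b' q hl).
rewrite [ev b.+1 _ _ _]/= nF // mulr0 addr0 big1 // => G _ /=.
case: ifP => _; first by rewrite /= (nF _ _ l) // !mulr0.
case: ifP => _ /=; first by rewrite nF // mulr0.
by rewrite nF ?mulr0 // mem_keys_ins Fl orbT.
Qed.

End Degree.

(** * Exponent functions, their degree, and the triangular pairing *)

Section Exponents.
Variables (T : finType) (L : smlattice T).
Implicit Types (F G H K : T) (l : seq (T * nat)) (m : T -> nat) (s : seq T).

Local Notation "x <=L y" := (sle L x y) (at level 70).
Local Notation "x <L y" := (slt L x y) (at level 70).
Local Notation rk := (srk L).
Local Notation d x y := (rk y - rk x)%N.
Local Notation b := (sbot L).
Local Notation E := (stop L).
Local Notation ev := (ev L).
Local Notation ins := (ins L).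
Local Notation keys l := (map (@fst T nat) l).

(** Sorting by rank yields a linear extension. The bottom is left out because x_b = 1, the top
    because its exponent is the first argument of [ev]. *)
Definition inner : seq T :=
  sort (relpre rk leq) [seq x <- enum T | (x != b) && (x != E)].

Definition linext s := uniq s && pairwise (fun x y => ~~ (y <L x)) s.

Lemma mem_inner x : (x \in inner) = (x != b) && (x != E).
Proof. by rewrite mem_sort mem_filter mem_enum andbT. Qed.

Lemma linext_inner : linext inner.
Proof.
rewrite /linext sort_uniq filter_uniq ?enum_uniq //=.
have : pairwise (relpre rk leq) inner.
  rewrite -sorted_pairwise; first by apply: sort_sorted => x y; apply: leq_total.
  by move=> x y z; apply: leq_trans.
by apply: sub_pairwise => x y /= h; apply: contraTN h => /slt_rk; rewrite -ltnNge.
Qed.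

Lemma linext_cons K s : linext (K :: s) ->
  [/\ linext s, K \notin s & forall G, G \in s -> ~~ (G <=L K)].
Proof.
rewrite /linext /= => /andP[/andP[nK us] /andP[/allP a p]]; rewrite us p; split=> //.
move=> G Gs; rewrite sle_eqVlt negb_or a // andbT.
by apply: contraNneq nK => <-.
Qed.

Definition blocks s m := [seq (G, m G) | G <- s & (0 < m G)%N].

Lemma blocks_cons K s m :
  blocks (K :: s) m = if (0 < m K)%N then (K, m K) :: blocks s m else blocks s m.
Proof. by rewrite /blocks /=; case: ifP. Qed.

Definition incr m G : T -> nat := fun K => (m K + (K == G))%N.

Lemma eq_blocks s m1 m2 : {in s, m1 =1 m2} -> blocks s m1 = blocks s m2.
Proof.
rewrite /blocks => h.
have -> : [seq G <- s | (0 < m1 G)%N] = [seq G <- s | (0 < m2 G)%N].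
  by apply: eq_in_filter => x xs; rewrite h.
by apply/eq_in_map => x; rewrite mem_filter => /andP[_ xs]; rewrite h.
Qed.

Lemma exps_pos_blocks s m : exps_pos (blocks s m).
Proof. by apply/allP => p /mapP[G]; rewrite mem_filter => /andP[h _] ->. Qed.

Lemma keys_blocks s m K : (K \in keys (blocks s m)) = (0 < m K)%N && (K \in s).
Proof. by rewrite -map_comp map_id mem_filter. Qed.

(** The two lists may differ: [incr] follows the order of [s], whereas [ins] moves [G] past a block
    incomparable to it. In that case neither list is a chain and both sides are 0. *)
Lemma ev_blocks_incr s c F e m G : linext s -> G \in s ->
  ev c F e (blocks s (incr m G)) = ev c F e (ins G (blocks s m)).
Proof.
elim: s F e => [//|K s IH] F e /linext_cons[ls nK lK]; rewrite inE !blocks_cons.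
rewrite {1 2}/incr; case: (eqVneq G K) => [eGK _|nGK /= Gs].
  have -> : blocks s (incr m G) = blocks s m.
    apply: eq_blocks => H Hs; rewrite /incr; case: eqP => [e'|]; last by rewrite addn0.
    by rewrite -eGK -e' Hs in nK.
  rewrite -{K}eGK in nK lK *.
  rewrite addn1 /=; case: posnP => [->|mG] /=; last by rewrite sltxx eqxx.
  move: (keys_blocks s m) => kb; case E': (blocks s m) kb => [//|[K' c'] l] kb /=.
  have /andP[mK' K's] : (0 < m K')%N && (K' \in s) by rewrite -kb mem_head.
  have /negPf nGK' : G != K' by apply: contraNneq nK => ->.
  case: ifP => // /negbT nlt; rewrite nGK' /= /wt (negPf nlt) !mul0r ?mulr0.
  have [ltF|] := boolP (F <L K'); last by rewrite !mul0r.
  rewrite [ev _ K' _ _]ev_ins0 ?mulr0 //.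
  by apply/negP => /sltW; apply/negP/lK.
rewrite addn0; case: posnP => mK /=; first exact: IH.
have -> : G <L K = false by apply/negbTE; apply: contra (lK _ Gs); apply: sltW.
by rewrite (negPf nGK) /= -IH.
Qed.

Definition deg m : rat := if m b == 0%N then ev (m E) b 0 (blocks inner m) else 0.

Lemma eq_deg m1 m2 : m1 =1 m2 -> deg m1 = deg m2.
Proof. by move=> h; rewrite /deg !h (eq_blocks (in1W h)). Qed.

Lemma ev_has_top c F e l : E \in keys l -> ev c F e l = 0.
Proof.
elim: l F e => [//|[K k] l IH] F e /=; rewrite inE => /orP[/eqP<-|h].
  by rewrite ev_top0 mulr0.
by rewrite IH ?mulr0.
Qed.

Lemma ev_incomp c F0 e l F G : F \in keys l -> G \in keys l ->
  ~~ (F <=L G) -> ~~ (G <=L F) -> ev c F0 e l = 0.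
Proof.
move=> + + nFG nGF; elim: l F0 e => [//|[K k] l IH] F0 e /=; rewrite !inE.
have N (x y : T) : ~~ (x <=L y) -> ~~ (x <L y) by apply: contra; apply: sltW.
case: (eqVneq F K) => [<- _|_ /= Fl].
  case: (eqVneq G F) nGF => [->|_ _ /= Gl]; first by rewrite sle_refl.
  by rewrite (ev_key0 _ _ Gl) ?mulr0 ?N.
case: (eqVneq G K) => [<- _|_ /= Gl]; first by rewrite (ev_key0 _ _ Fl) ?mulr0 ?N.
by rewrite IH ?mulr0.
Qed.

Lemma deg_incomp m F G : (0 < m F)%N -> (0 < m G)%N ->
  ~~ (F <=L G) -> ~~ (G <=L F) -> deg m = 0.
Proof.
move=> mF mG nFG nGF; rewrite /deg; case: ifP => // _.
have I x y : ~~ (x <=L y) -> ~~ (y <=L x) -> x \in inner.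
  move=> n1 n2; rewrite mem_inner; apply/andP; split.
    by apply: contraNneq n1 => ->; apply: sle_bot.
  by apply: contraNneq n2 => ->; apply: sle_top.
by apply: (@ev_incomp _ _ _ _ F G); rewrite ?keys_blocks ?mF ?mG ?(I F G) ?(I G F).
Qed.

Hypothesis nontriv : b != E.

Lemma deg_cover m F H : covers L F H -> F = b \/ (0 < m F)%N ->
  \sum_(G | H <=L G) deg (incr m G) = 0.
Proof.
move=> cFH hF; have lFH := covers_lt cFH.
have nHb G : H <=L G -> G != b.
  by move=> h; apply: contraTneq (slt_le_trans lFH h) => ->; apply/negP => /sltNge; rewrite sle_bot.
have [mb|mb] := eqVneq (m b) 0%N; last first.
  by rewrite big1 // => G hG; rewrite /deg /incr addn_eq0 (negPf mb).
have hF' : F = b \/ F \in keys (blocks inner m).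
  case: hF => [|mF]; [by left|right]; rewrite keys_blocks mF mem_inner /=; apply/andP; split.
    by apply: contraTneq mF => ->; rewrite mb.
  by apply: contraTneq lFH => ->; apply/negP => /sltNge; rewrite sle_top.
have := ev_alpha (m E) 0 (exps_pos_blocks inner m) hF' cFH.
(* In [ev_alpha] the insertion of [E] gives 0, and the summand with raised first argument is the
   term G = E of the claim. *)
rewrite (bigD1 E) ?sle_top //= ev_has_top ?add0r => [h|]; last first.
  by rewrite mem_keys_ins eqxx.
rewrite (bigD1 E) ?sle_top //= addrC -[RHS]h; congr (_ + _).
  apply: eq_bigr => G /andP[hG nGE]; rewrite /deg /incr mb [b == G]eq_sym (negPf (nHb _ hG)) /=.
  rewrite [E == G]eq_sym (negPf nGE) addn0 ev_blocks_incr ?linext_inner //.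
  by rewrite mem_inner nHb.
rewrite /deg /incr mb (negPf nontriv) eqxx addn1 /=; congr ev.
by apply: eq_blocks => G; rewrite mem_inner => /andP[_ /negPf->]; rewrite addn0.
Qed.

Lemma ev_degree c F e l : ev c F e l != 0 ->
  (rk F + e + sumn (unzip2 l) + c).+1 = rk E.
Proof.
elim: l F e => [|[K k] l IH] F e /=.
  case: (_ =P d F E) => [h _|_]; last by rewrite eqxx.
  by have := sle_rk (sle_top L F); lia.
rewrite mulf_eq0 negb_or /wt; case: ifP => [/andP[lt le] /andP[_ /IH]|]; last by rewrite eqxx.
by have := slt_rk lt; lia.
Qed.

Lemma sumn_blocks s m : sumn (unzip2 (blocks s m)) = (\sum_(G <- s) m G)%N.
Proof.
elim: s => [|K s IH]; first by rewrite big_nil.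
by rewrite blocks_cons big_cons -IH; case: posnP => [->|].
Qed.

Lemma deg_degree m : deg m != 0 -> (\sum_G m G).+1 = rk E.
Proof.
rewrite /deg; case: (_ =P 0%N) => [mb|]; last by rewrite eqxx.
move=> /ev_degree <-; congr S; rewrite srk_bot !add0n.
rewrite (bigD1 b) //= mb add0n (bigD1 E) 1?eq_sym //= addnC; congr addn.
rewrite sumn_blocks big_uniq; last by have /andP[] := linext_inner.
by apply: eq_bigl => G; rewrite mem_inner.
Qed.

(* Feichtner--Yuzvinsky monomials: chains F_1 < F_2 < ... with exponents at most
   rk F_i - rk F_(i-1) - 1; the chain may contain the top. *)
Definition below m K := \max_(F | (F <L K) && (0 < m F)%N) rk F.

Definition fy m := [forall K, (0 < m K)%N ==> ((m K + below m K < rk K)%N &&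
  [forall F, (0 < m F)%N ==> (F <=L K) || (K <=L F)])].

(* The complementary exponents: [m + dual m] has top degree, and its degree is 1 or -1. *)
Definition dual m K :=
  if K == E then (rk E - below m E - m E).-1
  else if (0 < m K)%N then (rk K - below m K - m K)%N else 0%N.

Lemma fy_lt m K : fy m -> (0 < m K)%N -> (m K + below m K < rk K)%N.
Proof. by move=> /forallP/(_ K)/implyP h /h /andP[]. Qed.

Lemma fy_chain m F K : fy m -> (0 < m F)%N -> (0 < m K)%N -> (F <=L K) || (K <=L F).
Proof. by move=> /forallP/(_ K)/implyP h mF /h /andP[_ /forallP/(_ F)]; rewrite mF. Qed.

Lemma fy_bot m : fy m -> m b = 0%N.
Proof. by move=> f; apply/eqP; rewrite -leqn0 leqNgt; apply/negP => /(fy_lt f); rewrite srk_bot. Qed.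

(* [F] is the largest element of the support of [m] that precedes the suffix [s] of [inner]. *)
Definition last_before m s F :=
  [/\ F = b \/ (0 < m F)%N, F != E,
      forall G, (0 < m G)%N -> G \in s \/ G = E \/ G <=L F,
      {subset s <= inner} & forall G, G \in s -> ~~ (G <=L F)].

Lemma below_last m s F K : fy m -> last_before m s F -> F <L K ->
  (forall G, G \in s -> ~~ (G <L K)) -> below m K = rk F.
Proof.
move=> f [hF _ hm _ _] ltFK sK; apply/eqP; rewrite eqn_leq; apply/andP; split.
  apply/bigmax_leqP => G /andP[ltG mG]; case: (hm G mG) => [/sK|[eG|/sle_rk //]].
    by rewrite ltG.
  by move: ltG; rewrite eG => /sltNge; rewrite sle_top.
case: hF => [->|mF]; first by rewrite srk_bot.
by apply: (@leq_bigmax_cond _ _ rk F); rewrite ltFK.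
Qed.

Lemma last_before_skip m K s F : linext (K :: s) -> last_before m (K :: s) F ->
  m K = 0%N -> last_before m s F.
Proof.
move=> /linext_cons[_ _ _] [hF nE hm ss hs] mK; split=> // [G mG|G Gs|G Gs].
- case: (hm G mG) => [|]; last by right.
  by rewrite inE; case: eqP mG => [->|_ _ /=]; [rewrite mK | left].
- by apply: ss; rewrite inE Gs orbT.
- by apply: hs; rewrite inE Gs orbT.
Qed.

Lemma last_before_take m K s F : fy m -> linext (K :: s) -> last_before m (K :: s) F ->
  (0 < m K)%N -> [/\ F <L K, below m K = rk F & last_before m s K].
Proof.
move=> f ls lb mK; have [hF nE hm ss hs] := lb; have [l1 nK lK] := linext_cons ls.
have Ki : K \in inner by apply: ss; rewrite mem_head.
have [nb nKE] : K != b /\ K != E by apply/andP; rewrite -mem_inner.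
have lt : F <L K.
  rewrite /slt; have := hs K (mem_head _ _); case: eqP => [->|_] /=; first by rewrite sle_refl.
  by case: hF => [-> _|mF]; [apply: sle_bot | have := fy_chain f mF mK; case: (K <=L F); rewrite ?orbF].
split=> //.
  apply: (below_last f lb) => // G; rewrite inE => /orP[/eqP->|/lK]; first by rewrite sltxx.
  by apply: contra; apply: sltW.
split=> // [|G mG|G Gs]; first by right.
  case: (hm G mG) => [|[|l]]; [|by right; left|].
    by rewrite inE => /orP[/eqP->|]; [right; right; apply: sle_refl | left].
  by right; right; apply: sle_trans (sltW lt).
by apply: ss; rewrite inE Gs orbT.
Qed.

Lemma last_before_bot m : fy m -> last_before m inner b.
Proof.
move=> f; split=> // [|G mG|G]; first by left.
  rewrite mem_inner; have [->|_] := eqVneq G E; first by right; left.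
  by left; rewrite andbT; apply: contraTneq mG => ->; rewrite (fy_bot f).
rewrite mem_inner => /andP[n _]; apply: contra n => l.
by apply/eqP/(@sle_anti _ L); rewrite l sle_bot.
Qed.

(** With no beta left over, the weight of a block [K] of [m'] needs d F K <= m K + (d F K - m' K),
    that is m' K <= m K. Strict inequality settles the lexicographic order; equality leaves beta
    exponent 0 again, and the comparison continues from [K]. *)
Lemma ev_dual_lexi s F c m m' : fy m' -> linext s -> last_before m' s F ->
  ev c F 0 (blocks s (fun G => m G + dual m' G)%N) != 0 ->
  ([seq m' G | G <- s] <= [seq m G | G <- s] :> seqlexi nat)%O.
Proof.
move=> f; elim: s F => [//|K s IH] F ls lb; rewrite blocks_cons /= lexi_cons.
have [l1 nK lK] := linext_cons ls.
have nKE : K == E = false.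
  have [_ _ _ ss _] := lb; have := ss K (mem_head _ _).
  by rewrite mem_inner => /andP[_ /negbTE].
rewrite {1 2}/dual nKE; case: (posnP (m' K)) => mK'.
  rewrite !leEnat mK' addn0 /=; case: posnP => [->|mK _] /=; last by rewrite leqNgt mK.
  by apply: IH => //; apply: last_before_skip ls lb mK'.
have [lt eb lb'] := last_before_take f ls lb mK'.
have := fy_lt f mK'; rewrite eb => lt'; rewrite ifT; last by lia.
rewrite /= /wt lt /= !leEnat; case: (leqP (m' K) (m K)) => [le|lt2]; last first.
  by rewrite ifF ?mul0r ?eqxx //; lia.
rewrite mulf_eq0 negb_or => /andP[_]; case: leqP => //= le2.
have -> : (0 + (m K + (rk K - rk F - m' K)) - d F K = 0)%N by lia.
exact: IH.
Qed.

(** Every block has total exponent exactly d F K, so beta never accumulates, all binomials are 'C(_,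
    0) and all coefficients are [rho 0] = 1; only signs remain. *)
Lemma ev_dual_neq0 s F m : fy m -> linext s -> last_before m s F ->
  ev (m E + dual m E) F 0 (blocks s (fun G => m G + dual m G)%N) != 0.
Proof.
move=> f; elim: s F => [|K s IH] F ls lb.
  have [_ nFE _ _ _] := lb; have ltE : F <L E by rewrite /slt nFE sle_top.
  have eb : below m E = rk F by apply: (below_last f lb).
  rewrite /= /dual eqxx eb; have rFE := slt_rk ltE.
  rewrite ifT ?mulr1 ?expf_neq0 // ?oppr_eq0 ?oner_eq0 //.
  by case: (posnP (m E)) => [->|/(fy_lt f)]; rewrite ?eb; lia.
have [l1 nK lK] := linext_cons ls; rewrite blocks_cons.
have -> : dual m K = if (0 < m K)%N then (rk K - below m K - m K)%N else 0%N.
  have [_ _ _ ss _] := lb; have := ss K (mem_head _ _).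
  by rewrite mem_inner /dual => /andP[_ /negbTE->].
case: (posnP (m K)) => mK; first by rewrite mK; apply: IH => //; apply: last_before_skip ls lb mK.
have [lt eb lb'] := last_before_take f ls lb mK.
have := fy_lt f mK; have rFK := slt_rk lt; rewrite eb => lt'; rewrite ifT; last by lia.
rewrite /= /wt lt /= (_ : (m K + (rk K - rk F - m K) = d F K)%N); last by lia.
rewrite add0n leqnn subnn bin0 mulr1 mulf_neq0 ?IH //.
by rewrite mulr1 expf_neq0 // oppr_eq0 oner_eq0.
Qed.

Lemma dual_bot m : fy m -> dual m b = 0%N.
Proof. by move=> f; rewrite /dual (negPf nontriv) (fy_bot f). Qed.

Lemma deg_dual_neq0 m : fy m -> deg (fun G => m G + dual m G)%N != 0.
Proof.
move=> f; rewrite /deg (fy_bot f) (dual_bot f) /=.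
by apply: ev_dual_neq0 => //; [apply: linext_inner | apply: last_before_bot].
Qed.

Lemma deg_dual_lexi m m' : fy m' -> deg (fun G => m G + dual m' G)%N != 0 ->
  ([seq m' G | G <- inner] <= [seq m G | G <- inner] :> seqlexi nat)%O.
Proof.
move=> f; rewrite /deg; case: ifP => [_|]; last by rewrite eqxx.
by apply: ev_dual_lexi => //; [apply: linext_inner | apply: last_before_bot].
Qed.

(** The exponent of the bottom is 0 and that of the top is determined by the total degree. *)
Lemma inner_inj m m' : fy m -> fy m' -> (\sum_G m G = \sum_G m' G)%N ->
  [seq m G | G <- inner] = [seq m' G | G <- inner] -> m =1 m'.
Proof.
move=> f f' + /eq_in_map h; have D G : G != E -> m G = m' G.
  have [->|nb nE] := eqVneq G b; first by rewrite !fy_bot.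
  by apply: h; rewrite mem_inner nb.
rewrite (bigD1 E) //= [RHS](bigD1 E) //= (eq_bigr m') => [/addIn e G|G /D //].
by have [->|/D] := eqVneq G E.
Qed.

End Exponents.

(** * Feichtner--Yuzvinsky monomials span *)

Record is_ideal (A : comNzRingType) (I : A -> Prop) : Prop := IsIdeal {
  ideal0 : I 0;
  idealD : forall p q, I p -> I q -> I (p + q);
  idealMl : forall a p, I p -> I (a * p)
}.

Lemma ideal_sum (A : comNzRingType) (I : A -> Prop) (J : finType) (P : pred J) (f : J -> A) :
  is_ideal I -> (forall i, P i -> I (f i)) -> I (\sum_(i | P i) f i).
Proof. by case=> I0 ID _ h; apply: big_ind. Qed.

(** This is the largest ideal inside the kernel of [lam]. It is used for a functional given by a
    kernel vector of [ideal_mx] and for the degree map. *)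
Lemma ideal_annihilator (A : comNzRingType) (lam : A -> rat) :
  {morph lam : x y / x + y} -> is_ideal (fun p => forall a, lam (a * p) = 0).
Proof.
move=> lamD; have lam0 : lam 0 = 0 by apply: (addIr (lam 0)); rewrite -lamD !add0r.
split=> [a|p q hp hq a|a p hp c]; first by rewrite mulr0.
  by rewrite mulrDr lamD hp hq addr0.
by rewrite mulrA.
Qed.

Section ChowRelations.
Variables (T : finType) (L : smlattice T).
Implicit Types (F G H K : T).

Local Notation "x <=L y" := (sle L x y) (at level 70).
Local Notation "x <L y" := (slt L x y) (at level 70).
Local Notation rk := (srk L).
Local Notation d x y := (rk y - rk x)%N.
Local Notation "x \v y" := (sjoin L x y) (at level 50).
Local Notation b := (sbot L).
Local Notation E := (stop L).

Record chow_rel (A : comNzRingType) (I : A -> Prop) (xi : T -> A) : Prop := ChowRel {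
  chow_bot : xi b = 1;
  chow_incomp : forall F G, ~~ (F <=L G) -> ~~ (G <=L F) -> I (xi F * xi G);
  chow_cover : forall F H, covers L F H -> I (xi F * \sum_(G | H <=L G) xi G)
}.

Section Spanning.
Variables (A : comNzRingType) (lam : A -> rat) (xi : T -> A).
Hypothesis lamD : {morph lam : x y / x + y}.
Let I p := forall a, lam (a * p) = 0.
Hypothesis rel : chow_rel I xi.

Let II : is_ideal I := ideal_annihilator lamD.
Let y H := \sum_(G | H <=L G) xi G.

(** A [G] above [H] but not above F v H is incomparable to [F], so x_F kills x_G: next to x_F, y_H
    and y_(F v H) are interchangeable. *)
Lemma upsum_join_pow F H p : ~~ (H <=L F) ->
  I (xi F * y H ^+ p - xi F * y (F \v H) ^+ p).
Proof.
move=> nHF; set J := F \v H.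
have base : I (xi F * y H - xi F * y J).
  rewrite -mulrBr /y (bigID (fun G => J <=L G)) /= [X in X + _ - _](_ : _ = y J); last first.
    by apply: eq_bigl => G; rewrite andbC /J sle_join -andbA andbb.
  rewrite addrC addKr mulr_sumr; apply: ideal_sum II _ => G /andP[lHG nJG].
  apply: (chow_incomp rel); first by apply: contra nJG => lFG; rewrite /J sle_join lFG.
  by apply: contra nHF; apply: sle_trans.
elim: p => [|p IH]; first by rewrite subrr; apply: ideal0 II.
have -> : xi F * y H ^+ p.+1 - xi F * y J ^+ p.+1 =
  y H * (xi F * y H ^+ p - xi F * y J ^+ p) + y J ^+ p * (xi F * y H - xi F * y J).
  by rewrite !exprS; ring.
by apply: (idealD II); apply: (idealMl II).
Qed.

(* Induction on d F H: expand x_F * y_K for a cover K of F below H and multiply by y_H^(d - 1);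
   by semimodularity the terms with G not above H die by induction. *)
Lemma chow_pow F H : F <L H -> I (xi F * y H ^+ d F H).
Proof.
have [m] := ubnP (d F H); elim: m F H => // m IH F H ltm lt; have r := slt_rk lt.
have /andP[nFH lFH] := lt; have [K [lFK lKH rK]] := srk_cover lFH nFH.
have cK : covers L F K by rewrite /covers lFK rK eqxx.
have [eKH|nKH] := eqVneq K H.
  by rewrite -eKH rK subSn // subnn expr1; apply: (chow_cover rel).
have ltKH : K <L H by rewrite /slt nKH.
have rKH := slt_rk ltKH.
have -> : d F H = (d K H).+1 by lia.
have main : I (y H ^+ d K H * (xi F * y K)).
  by apply: (idealMl II); apply: (chow_cover rel).
rewrite {2}/y (bigID (fun G => H <=L G)) /= [X in xi F * (X + _)](_ : _ = y H) in main; last first.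
  by apply: eq_bigl => G; apply/andP/idP => [[]//|h]; split=> //; apply: sle_trans h.
have rest : I (y H ^+ d K H * (xi F * \sum_(G | (K <=L G) && ~~ (H <=L G)) xi G)).
  rewrite mulrCA; apply: (idealMl II); rewrite mulr_sumr; apply: ideal_sum II _ => G /andP[lKG nHG].
  set J := G \v H.
  have ltGJ : G <L J.
    by rewrite /slt sjoinl andbT; apply: contraNneq nHG => ->; apply: sjoinr.
  have rGJ := slt_rk ltGJ; have sm := srk_semimod lKG lKH; rewrite -/J in sm.
  have rKG := sle_rk lKG.
  have /(idealMl II (y J ^+ (d K H - d G J))) hJ : I (xi G * y J ^+ d G J) by apply: IH => //; lia.
  rewrite mulrCA -exprD subnK in hJ; last by lia.
  by rewrite mulrC -[X in I X](subrK (xi G * y J ^+ d K H)); apply: (idealD II) => //; apply: upsum_join_pow.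
have -> : xi F * y H ^+ (d K H).+1 = y H ^+ d K H *
    (xi F * (y H + \sum_(G | (K <=L G) && ~~ (H <=L G)) xi G)) +
    (- 1) * (y H ^+ d K H * (xi F * \sum_(G | (K <=L G) && ~~ (H <=L G)) xi G)).
  by rewrite exprS; ring.
by apply: (idealD II) => //; apply: (idealMl II).
Qed.

Let xprod w := \prod_(x <- w) xi x.

Let xprod_cons x w : xprod (x :: w) = xi x * xprod w.
Proof. exact: big_cons. Qed.

Let xprod_cat v w : xprod (v ++ w) = xprod v * xprod w.
Proof. exact: big_cat. Qed.

Let xprod_nseq i K : xprod (nseq i K) = xi K ^+ i.
Proof. by elim: i => [|i IH]; rewrite /xprod ?big_nil //= big_cons exprS -IH. Qed.

Let lam0 : lam 0 = 0. Proof. by apply: (addIr (lam 0)); rewrite -lamD !add0r. Qed.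

Let lam_sum (P : pred T) (f : T -> A) :
  lam (\sum_(i | P i) f i) = \sum_(i | P i) lam (f i).
Proof. exact: (big_morph lam lamD lam0). Qed.

Lemma lam_upsum_pow K p w :
  (forall w', size w' = p -> all (fun x => K <=L x) w' -> lam (xprod (w' ++ w)) = 0) ->
  lam (xprod w * y K ^+ p) = 0.
Proof.
elim: p w => [|p IH] w h; first by rewrite expr0 mulr1 (h [::]).
rewrite exprSr mulrA {2}/y mulr_sumr lam_sum big1 // => G lKG.
rewrite mulrAC -[xprod w * xi G]mulrC -/(xprod w).
have -> : xi G * xprod w = xprod (G :: w) by rewrite /xprod big_cons.
apply: IH => w' sw' aw'; have -> : xprod (w' ++ G :: w) = xprod ((G :: w') ++ w).
  by apply: perm_big; rewrite perm_catC /= perm_cons perm_catC.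
by apply: h; rewrite /= ?sw' ?lKG.
Qed.

Local Notation cnt w := (fun G : T => count_mem G w).

Lemma not_fy_word w : b \notin w -> ~~ fy L (cnt w) ->
  (exists F K, [/\ ~~ (F <=L K), ~~ (K <=L F), F \in w & K \in w]) \/
  (exists F K, [/\ F <L K, F = b \/ F \in w & (d F K <= count_mem K w)%N]).
Proof.
have cntE x : (0 < count_mem x w)%N = (x \in w) by rewrite -has_count has_pred1.
move=> nb; rewrite negb_forall => /existsP[K]; rewrite negb_imply negb_and cntE.
case/andP=> Kw /orP[|]; last first.
  rewrite negb_forall => /existsP[F]; rewrite negb_imply cntE negb_or => /andP[Fw /andP[h1 h2]].
  by left; exists F, K.
rewrite -leqNgt => le; right.
case: (posnP #|[pred F | (F <L K) && (0 < count_mem F w)%N]|) => [/card0_eq e|].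
  exists b, K; split; [|by left|].
    by rewrite /slt sle_bot andbT; apply: contraNneq nb => ->.
  move: le; rewrite /below big_pred0 => [|G]; last by have := e G; rewrite inE.
  by rewrite srk_bot addn0 subn0.
move=> /(eq_bigmax_cond rk) [F /andP[ltF Fw] e]; exists F, K; split=> //.
  by right; rewrite -cntE.
by move: le; rewrite /below e; lia.
Qed.

Lemma sum_rk_le w : (\sum_(x <- w) rk x <= size w * rk E)%N.
Proof.
elim: w => [|x w IH]; first by rewrite big_nil.
by rewrite big_cons /= mulSn leq_add // sle_rk ?sle_top.
Qed.

(* Rewriting a non-FY factor x_F x_K^d with [chow_pow] strictly increases the sum of the ranks. *)
Lemma span_words j :
  (forall w, size w = j -> b \notin w -> fy L (cnt w) -> lam (xprod w) = 0) ->
  forall w, size w = j -> b \notin w -> lam (xprod w) = 0.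
Proof.
move=> hfy w; have [m] := ubnP (j * rk E - \sum_(x <- w) rk x)%N.
elim: m w => // m IH w ltm sw nb.
have [f|/(not_fy_word nb)[[F [K [n1 n2 Fw Kw]]]|[F [K [lt hF le]]]]] := boolP (fy L (cnt w)).
- exact: hfy.
- have nFK : K != F by apply: contraNneq n1 => ->; apply: sle_refl.
  have -> : xprod w = xprod (rem K (rem F w)) * (xi F * xi K).
    rewrite /xprod (perm_big _ (perm_to_rem Fw)) big_cons /=.
    rewrite (perm_big _ (@perm_to_rem _ K (rem F w) _)) ?big_cons /=; first by ring.
    exact: rem_mem.
  exact: (chow_incomp rel).
have nbK : K != b by apply: contraTneq lt => ->; apply/negP => /sltNge; rewrite sle_bot.
(* The word is split into x_K^(d F K) and the rest [w1]; from [w1] a factor x_F is then extracted,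
   or x_b = 1 if F = b. *)
set w1 := nseq (count_mem K w - d F K) K ++ filter (predC1 K) w.
have pw : perm_eq w (nseq (d F K) K ++ w1).
  rewrite /w1 catA -nseqD subnKC //; have /all_pred1P := filter_all (pred1 K) w.
  by rewrite size_filter => <-; rewrite perm_sym; apply/permPl/perm_filterC.
have [q eq] : exists q, xprod w1 = xprod q * xi F.
  case: hF => [->|Fw]; first by exists w1; rewrite (chow_bot rel) mulr1.
  exists (rem F w1); rewrite mulrC /xprod (perm_big (F :: rem F w1)) ?big_cons //.
  apply: perm_to_rem; rewrite mem_cat mem_filter Fw /=.
  by rewrite (_ : F != K) ?orbT //; apply: contraTneq lt => ->; rewrite sltxx.
have nbw1 : b \notin w1.
  by apply: contra nb => h; rewrite (perm_mem pw) mem_cat h orbT.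
clearbody w1.
(* Starting from [chow_pow], the factors y_K are traded for x_K one at a time. The discarded terms
   contain some x_G with G > K and only further factors above [K], so their rank sum is larger and
   the induction hypothesis applies. *)
have step i : (i <= d F K)%N -> lam (xprod w1 * xi K ^+ i * y K ^+ (d F K - i)) = 0.
  elim: i => [_|i IHi lti].
    by rewrite expr0 mulr1 subn0 eq -mulrA; apply: chow_pow.
  have := IHi (ltnW lti); have -> : (d F K - i = (d F K - i.+1).+1)%N by lia.
  set p := (d F K - i.+1)%N.
  rewrite exprS {1}/y (bigD1 K) ?sle_refl //= mulrDl mulrDr lamD.
  have -> : xprod w1 * xi K ^+ i * (xi K * y K ^+ p) = xprod w1 * xi K ^+ i.+1 * y K ^+ p.
    by rewrite exprS; ring.
  rewrite mulr_suml mulr_sumr lam_sum big1 ?addr0 // => G /andP[lKG nGK].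
  have rKG : (rk K < rk G)%N by apply: slt_rk; rewrite /slt eq_sym nGK.
  have -> : xprod w1 * xi K ^+ i * (xi G * y K ^+ p) = xprod (G :: nseq i K ++ w1) * y K ^+ p.
    by rewrite xprod_cons xprod_cat xprod_nseq; ring.
  apply: lam_upsum_pow => w' sw' aw'; apply: IH.
  - have := sum_rk_le (w' ++ G :: nseq i K ++ w1); have := perm_size pw.
    have : (size w' * rk K <= \sum_(x <- w') rk x)%N.
      elim: (w') aw' => [|x v IHv] //= /andP[/sle_rk lx /IHv hv].
      by rewrite big_cons mulSn leq_add.
    move: ltm; rewrite (perm_big _ pw) /= !big_cat big_cons big_cat /= !big_nseq.
    rewrite !size_cat /= !size_cat !size_nseq sw sw' !iter_addn_0.
    set X := \sum_(x <- w') _; set Y := \sum_(x <- w1) _.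
    have Ep : (p + i.+1 = d F K)%N by rewrite /p; lia.
    nia.
  - have := perm_size pw; rewrite !size_cat /= !size_cat !size_nseq sw sw' /p; lia.
  - rewrite mem_cat inE mem_cat !negb_or nbw1 mem_nseq negb_and [b == K]eq_sym nbK orbT andbT.
    have N x : K <=L x -> b != x.
      by move=> l; apply: contraTneq l => <-; apply: contra nbK => l'; apply/eqP/(@sle_anti _ L); rewrite l' sle_bot.
    rewrite (N G lKG) !andbT; apply/negP => bw'; have /allP/(_ b bw') := aw'.
    by move=> /N; rewrite eqxx.
have := step _ (leqnn _); rewrite subnn expr0 mulr1 => <-; congr lam.
by rewrite {1}/xprod (perm_big _ pw) -/(xprod _) xprod_cat xprod_nseq mulrC.
Qed.

End Spanning.
End ChowRelations.

(** * The dimension of a presented Chow ring *)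

Lemma mpoly_linear0 n (f : {mpoly rat[n]} -> rat) :
  {morph f : p q / p + q} -> (forall c p, f (c *: p) = c * f p) ->
  (forall m, f 'X_[m] = 0) -> forall p, f p = 0.
Proof.
move=> fD fZ fX p; rewrite (mpolyE p).
elim/big_ind: _ => [|q r hq hr|m _]; last by rewrite fZ fX mulr0.
  by rewrite -(scale0r 0) fZ mul0r.
by rewrite fD hq hr addr0.
Qed.

Section DegreeMap.
Variables (T : finType) (L : smlattice T).
Implicit Types (F G H K : T).

Local Notation "x <=L y" := (sle L x y) (at level 70).
Local Notation "x <L y" := (slt L x y) (at level 70).
Local Notation rk := (srk L).
Local Notation b := (sbot L).
Local Notation E := (stop L).
Local Notation N := #|T|.
Local Notation S := {mpoly rat[#|T|]}.

Hypothesis nontriv : b != E.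

Definition var G : S := 'X_(enum_rank G).

Definition expo (u : 'X_{1..N}) G : nat := u (enum_rank G).

Definition multi (m : T -> nat) : 'X_{1..N} := [multinom m (enum_val i) | i < N].

Lemma multiK m : expo (multi m) =1 m.
Proof. by move=> G; rewrite /expo mnmE enum_rankK. Qed.

Lemma mdeg_expo u : mdeg u = (\sum_G expo u G)%N.
Proof. by rewrite mdegE (reindex enum_rank) //; apply/onW_bij/enum_rank_bij. Qed.

Lemma var_prod m : \prod_G var G ^+ m G = 'X_[multi m].
Proof.
rewrite [RHS]mpolyXE_id [RHS](reindex enum_rank) /=; last exact/onW_bij/enum_rank_bij.
by apply: eq_bigr => G _; rewrite mnmE enum_rankK.
Qed.

(** The linear extension of [deg]. By [deg_degree] only monomials of degree rk E - 1 count, so the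
    bound on the monomials loses nothing. *)
Definition Deg (p : S) : rat := \sum_(u : 'X_{1..N < rk E}) p@_u * deg L (expo u).

Lemma DegD : {morph Deg : p q / p + q}.
Proof.
by move=> p q; rewrite /Deg -big_split; apply: eq_bigr => u _; rewrite mcoeffD mulrDl.
Qed.

Lemma DegZ c p : Deg (c *: p) = c * Deg p.
Proof. by rewrite /Deg mulr_sumr; apply: eq_bigr => u _; rewrite mcoeffZ mulrA. Qed.

Lemma DegX u : Deg 'X_[u] = deg L (expo u).
Proof.
rewrite /Deg; case: (ltnP (mdeg u) (rk E)) => h.
  rewrite (bigD1 (BMultinom h)) //= mcoeffX eqxx mul1r big1 ?addr0 // => v nv.
  rewrite mcoeffX; case: eqP => [e|]; last by rewrite mul0r.
  by case/eqP: nv; apply: val_inj; rewrite /= e.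
rewrite big1 => [|v _].
  apply/esym/eqP; apply: contraTT h => /(deg_degree nontriv).
  by rewrite -mdeg_expo -ltnNge => <-.
rewrite mcoeffX; case: eqP => [e|]; last by rewrite mul0r.
by have := bmdeg v; rewrite ltnNge -e h.
Qed.

Lemma Deg_sum (J : finType) (P : pred J) (f : J -> S) :
  Deg (\sum_(i | P i) f i) = \sum_(i | P i) Deg (f i).
Proof. by apply: (big_morph Deg DegD); rewrite -(scale0r 0) DegZ mul0r. Qed.

(* The ideal of polynomials orthogonal to everything under the degree pairing. *)
Definition kill p := forall a, Deg (a * p) = 0.

Lemma kill_ideal : is_ideal kill. Proof. exact: ideal_annihilator DegD. Qed.

Lemma killX p : (forall u, Deg ('X_[u] * p) = 0) -> kill p.
Proof.
move=> h a; apply: (mpoly_linear0 (f := fun a => Deg (a * p))) => // [q r|c q].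
  by rewrite mulrDl DegD.
by rewrite -scalerAl DegZ.
Qed.

Definition xvar F : S := if F == b then 1 else var F.

Lemma chow_rel_kill : chow_rel L kill xvar.
Proof.
split=> [|F G nFG nGF|F H cFH]; first by rewrite /xvar eqxx.
  rewrite /xvar ifN; last by apply: contraNneq nFG => ->; apply: sle_bot.
  rewrite ifN; last by apply: contraNneq nGF => ->; apply: sle_bot.
  apply: killX => u; rewrite -!mpolyXD DegX.
  by apply: (deg_incomp (F := F) (G := G)) => //; rewrite /expo !mnmDE !mnm1E eqxx; lia.
apply: killX => u; rewrite mulrA.
have [v hv] : exists v, 'X_[u] * xvar F = 'X_[v] /\ (F = b \/ (0 < expo v F)%N).
  rewrite /xvar; case: eqP => [->|_]; first by exists u; rewrite mulr1; split=> //; left.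
  exists (u + U_(enum_rank F))%MM; rewrite mpolyXD; split=> //; right.
  by rewrite /expo mnmDE mnm1E eqxx addn1.
case: hv => -> hF; rewrite mulr_sumr Deg_sum -[RHS](deg_cover nontriv cFH hF).
apply: eq_bigr => G lHG; rewrite /xvar ifN.
  rewrite -mpolyXD DegX; apply: eq_deg => K.
  by rewrite /expo mnmDE mnm1E (inj_eq enum_rank_inj) /incr eq_sym.
apply: contraTneq (covers_lt cFH) => eG; apply/negP => lt.
by have /sltNge := slt_le_trans lt lHG; rewrite eG sle_bot.
Qed.

Definition fyset j : {set {ffun T -> 'I_j.+1}} :=
  [set u : {ffun T -> 'I_j.+1} | fy L (fun G => u G : nat) && ((\sum_G u G)%N == j)].

Section Presentation.
Variables (n : nat) (Gs : seq {mpoly rat[n]}) (xi : T -> {mpoly rat[n]}) (phi : n.-tuple S).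

(** [phi] maps the presented ring to [S] modulo [kill], and [xi] leads back. The first two fields
    serve the spanning argument, the other three the independence. The condition a b = 0 keeps the
    constant [xi b] = 1 out of the linear forms. *)
Record presentation : Prop := Presentation {
  pres_rel : forall I, is_ideal I -> (forall g, g \in Gs -> I g) -> chow_rel L I xi;
  pres_gen : forall I, is_ideal I -> (forall g, g \in Gs -> I g) ->
    forall i, exists a : T -> rat, a b = 0 /\ I ('X_i - \sum_G a G *: xi G);
  pres_homog : forall i, tnth phi i \is 1.-homog;
  pres_kill : forall g, g \in Gs -> kill (g \mPo phi);
  pres_inv : forall G, G != b -> kill (xi G \mPo phi - var G)
}.

Hypothesis pres : presentation.
Variable j : nat.
Local Notation M := #|deg_monos n j|.
Local Notation B := #|fyset j|.

Definition dmono (c : 'I_M) : 'X_{1..n} := val (enum_val c).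

Lemma mdeg_dmono c : mdeg (dmono c) = j.
Proof. by have := enum_valP c; rewrite inE => /eqP. Qed.

Lemma dmono_surj m : mdeg m = j -> exists c, dmono c = m.
Proof.
move=> h; have lt : (mdeg m < j.+1)%N by rewrite h.
have mi : BMultinom lt \in deg_monos n j by rewrite inE /= h.
by exists (enum_rank_in mi (BMultinom lt)); rewrite /dmono enum_rankK_in.
Qed.

Lemma dmono_inj : injective dmono.
Proof. by move=> c c' /val_inj /enum_val_inj. Qed.

Definition coeffs (k : 'I_M -> rat) (p : {mpoly rat[n]}) : rat :=
  \sum_c p@_(dmono c) * k c.

Lemma coeffsD k : {morph coeffs k : p q / p + q}.
Proof.
by move=> p q; rewrite /coeffs -big_split; apply: eq_bigr => u _; rewrite mcoeffD mulrDl.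
Qed.

Lemma coeffsZ k c p : coeffs k (c *: p) = c * coeffs k p.
Proof. by rewrite /coeffs mulr_sumr; apply: eq_bigr => u _; rewrite mcoeffZ mulrA. Qed.

Lemma coeffsX k c : coeffs k 'X_[dmono c] = k c.
Proof.
rewrite /coeffs (bigD1 c) //= mcoeffX eqxx mul1r big1 ?addr0 // => c' nc.
by rewrite mcoeffX (inj_eq dmono_inj) eq_sym (negPf nc) mul0r.
Qed.

Lemma coeffsX0 k m : mdeg m != j -> coeffs k 'X_[m] = 0.
Proof.
move=> h; rewrite /coeffs big1 // => c _; rewrite mcoeffX; case: eqP => [e|]; last by rewrite mul0r.
by rewrite e mdeg_dmono eqxx in h.
Qed.

Lemma coeffs_ideal_mx (k : 'cV[rat]_M) : ideal_mx Gs j *m k = 0 ->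
  forall g, g \in Gs -> forall a, coeffs (k^~ 0) (a * g) = 0.
Proof.
move=> h g gG; apply: mpoly_linear0 => [p q|c p|m].
- by rewrite mulrDl coeffsD.
- by rewrite -scalerAl coeffsZ.
case: (ltnP (mdeg m) j.+1) => lt.
  have ig : (index g Gs < size Gs)%N by rewrite index_mem.
  have /matrixP/(_ (enum_rank (Ordinal ig, BMultinom lt)) 0) := h.
  rewrite mxE [RHS]mxE => e; rewrite -[RHS]e; apply: eq_bigr => c _; rewrite mxE enum_rankK /=.
  by rewrite nth_index.
(* A multiple by a monomial of degree above j has no part of degree j, whatever [g] is. *)
move: g {gG}; apply: mpoly_linear0 => [p q|c p|u].
- by rewrite mulrDr coeffsD.
- by rewrite -scalerAr coeffsZ.
by rewrite -mpolyXD coeffsX0 // mdegD; lia.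
Qed.

Definition fymono (i : 'I_B) : {mpoly rat[n]} := \prod_G xi G ^+ (enum_val i G).

Definition fymx : 'M_(B, M) := \matrix_(i, c) (fymono i)@_(dmono c).

Lemma prod_count w : \prod_(x <- w) xi x = \prod_G xi G ^+ count_mem G w.
Proof.
elim: w => [|x w IH]; first by rewrite big_nil big1.
rewrite big_cons IH [RHS](eq_bigr (fun G => xi G ^+ (x == G) * xi G ^+ count_mem G w)).
  rewrite big_split /=; congr (_ * _); rewrite (bigD1 x) //= eqxx expr1 big1 ?mulr1 // => G.
  by rewrite eq_sym => /negPf->.
by move=> G _; rewrite /= exprD.
Qed.

Lemma sum_count (w : seq T) : (\sum_G count_mem G w)%N = size w.
Proof.
elim: w => [|x w IH]; first by rewrite big1.
by rewrite /= big_split /= IH (bigD1 x) //= eqxx big1 // => G /negPf; rewrite eq_sym => ->.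
Qed.

Lemma span_zero (k : 'cV[rat]_M) : ideal_mx Gs j *m k = 0 -> fymx *m k = 0 -> k = 0.
Proof.
move=> hI hU; set lam := coeffs (k^~ 0).
have lamD := coeffsD (k^~ 0) : {morph lam : p q / p + q}.
have II := ideal_annihilator lamD.
have gI g : g \in Gs -> forall a, lam (a * g) = 0 by move=> gG; apply: coeffs_ideal_mx.
have rel := pres_rel pres II gI.
have words w : size w = j -> b \notin w -> lam (\prod_(x <- w) xi x) = 0.
  apply: (span_words lamD rel) => {}w sw nb f.
  pose u := [ffun G => inord (count_mem G w) : 'I_j.+1].
  have uE G : u G = count_mem G w :> nat by rewrite ffunE inordK // ltnS -sw count_size.
  have ui : u \in fyset j.
    rewrite inE; have -> : (\sum_G u G)%N = j.
      by rewrite -[RHS]sw -sum_count; apply: eq_bigr => G _; rewrite uE.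
    rewrite eqxx andbT.
    have eb K : below L (fun G => u G) K = below L (fun G => count_mem G w) K.
      by apply: eq_bigl => G; rewrite uE.
    apply/forallP => K; rewrite uE eb; apply/implyP => Kw; rewrite (fy_lt f) //=.
    by apply/forallP => F; apply/implyP; rewrite uE => Fw; apply: (fy_chain f).
  have /matrixP/(_ (enum_rank_in ui u) 0) := hU; rewrite mxE [RHS]mxE => e; rewrite -[RHS]e.
  rewrite prod_count; apply: eq_bigr => c _; rewrite mxE /fymono enum_rankK_in //.
  by under eq_bigr => G _ do rewrite -uE.
(* Products of a word in the [xi] and a monomial interpolate between the two generating systems:
   [pres_gen] converts one variable at a time until [words] applies. *)
suff monos p m w : mdeg m = p -> (size w + p = j)%N -> b \notin w ->
    lam (\prod_(x <- w) xi x * 'X_[m]) = 0.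
  apply/colP => c; rewrite [RHS]mxE -[LHS](coeffsX (k^~ 0) c).
  by have := monos j (dmono c) [::] (mdeg_dmono c); rewrite big_nil mul1r; apply.
elim: p m w => [|p IH] m w.
  by move/eqP; rewrite mdeg_eq0 => /eqP-> h nb; rewrite mpolyX0 mulr1 words // -h addn0.
move=> dm sw nb; have [i mi] : exists i, m i != 0%N.
  apply/existsP; apply: contra_eqT dm => /existsPn h.
  by rewrite mdegE big1 // => i _; apply/eqP; have := h i; rewrite negbK.
rewrite -(submK (m := U_(i)) (m' := m)); last by rewrite lep1mP.
have {}dm : mdeg (m - U_(i))%MM = p.
  have := congr1 (@mdeg n) (submK (m := U_(i)) (m' := m) _).
  by rewrite lep1mP mdegD mdeg1 addn1 dm => /(_ mi) [].
rewrite mpolyXD mulrA; set q := _ * 'X_[(m - _)].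
have [a [ab ha]] := pres_gen pres II gI i.
rewrite -(subrK (\sum_G a G *: xi G) 'X_i) mulrDr lamD ha add0r mulr_sumr.
have lam0 : lam 0 = 0 by rewrite -(scale0r 0) /lam coeffsZ mul0r.
rewrite (big_morph lam lamD lam0) big1 // => G _; rewrite -scalerAr /lam coeffsZ -/lam.
have [->|nG] := eqVneq G b; first by rewrite ab mul0r.
have -> : q * xi G = \prod_(x <- G :: w) xi x * 'X_[(m - U_(i))].
  by rewrite /q big_cons; ring.
rewrite IH ?mulr0 //; first by rewrite /= addSn -addnS.
by rewrite inE eq_sym (negPf nG).
Qed.

Definition pairing (v : 'I_B) (p : {mpoly rat[n]}) : rat :=
  Deg ((p \mPo phi) * 'X_[multi (dual L (fun G => enum_val v G))]).

Lemma fyset_fy (v : 'I_B) : fy L (fun G => enum_val v G : nat).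
Proof. by have := enum_valP v; rewrite inE => /andP[]. Qed.

Lemma fyset_sum (v : 'I_B) : (\sum_G (enum_val v G : nat))%N = j.
Proof. by have := enum_valP v; rewrite inE => /andP[_ /eqP]. Qed.

Lemma dual_degree (v : 'I_B) : (j + \sum_G dual L (fun G => enum_val v G) G)%N.+1 = rk E.
Proof.
rewrite -(deg_degree nontriv (deg_dual_neq0 nontriv (fyset_fy v))).
by rewrite big_split /= fyset_sum.
Qed.

Lemma pairingD v : {morph pairing v : p q / p + q}.
Proof. by move=> p q; rewrite /pairing raddfD mulrDl DegD. Qed.

Lemma pairingZ v c p : pairing v (c *: p) = c * pairing v p.
Proof. by rewrite /pairing linearZ -scalerAl DegZ. Qed.

(** The dual monomial has degree rk E - 1 - j and [phi] preserves degrees, so only degree j reaches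
    the top degree seen by [Deg]. *)
Lemma pairingX0 v m : mdeg m != j -> pairing v 'X_[m] = 0.
Proof.
move=> h; rewrite /pairing; set q := _ * _.
have hq : q \is (mdeg m + \sum_G dual L (fun G => enum_val v G) G).-homog.
  apply: dhomogM; last first.
    by rewrite dhomogX /= mdeg_expo; apply/eqP/eq_bigr => G _; rewrite multiK.
  rewrite comp_mpolyX mdegE; elim/big_rec2: _ => [|i k p _ hp]; first exact: dhomog1.
  by apply: dhomogM => //; have := dhomogMn (m i) (pres_homog pres i); rewrite mul1n.
rewrite /Deg big1 // => u _; have [u0|nu] := eqVneq q@_u 0; first by rewrite u0 mul0r.
have /(dhomog_mf hq) du : val u \in msupp q by rewrite mcoeff_msupp.
apply/eqP; rewrite mulf_eq0 (negPf nu) /=; apply: contraNT h => /(deg_degree nontriv).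
by rewrite -mdeg_expo du -(dual_degree v) => -[] /addIn ->.
Qed.

Lemma coeffs_pairing v p : coeffs (fun c => pairing v 'X_[dmono c]) p = pairing v p.
Proof.
apply/eqP; rewrite -subr_eq0; apply/eqP; move: p; apply: mpoly_linear0 => [p q|c p|m].
- by rewrite coeffsD pairingD; ring.
- by rewrite coeffsZ pairingZ; ring.
have [/dmono_surj[c <-]|h] := eqVneq (mdeg m) j; first by rewrite coeffsX subrr.
by rewrite coeffsX0 // pairingX0 // subrr.
Qed.

Definition pairmx : 'M_(M, B) := \matrix_(c, v) pairing v 'X_[dmono c].

Lemma ideal_pairmx : ideal_mx Gs j *m pairmx = 0.
Proof.
apply/matrixP => i v; rewrite !mxE.
transitivity (coeffs (fun c => pairing v 'X_[dmono c])
   ('X_[val (enum_val i).2] * Gs`_(enum_val i).1)).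
  by apply: eq_bigr => c _; rewrite !mxE.
rewrite coeffs_pairing /pairing rmorphM /= mulrAC; apply: (pres_kill pres).
by rewrite mem_nth.
Qed.

Lemma pairing_fymono i v : pairing v (fymono i) =
  deg L (fun G => enum_val i G + dual L (fun G => enum_val v G) G)%N.
Proof.
have K : kill ((fymono i \mPo phi) - \prod_G var G ^+ (enum_val i G)).
  rewrite /fymono rmorph_prod /=; have KI := kill_ideal.
  have kmul p p' q q' : kill (p - p') -> kill (q - q') -> kill (p * q - p' * q').
    move=> h1 h2; have -> : p * q - p' * q' = q * (p - p') + p' * (q - q') by ring.
    by apply: (idealD KI); apply: (idealMl KI).
  apply: (big_rec2 (fun x y => kill (x - y))); first by rewrite subrr; apply: (ideal0 KI).
  move=> G x y _ h; apply: (kmul) => //; rewrite rmorphXn /=.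
  have [->|nG] := eqVneq G b.
    by rewrite (fy_bot (fyset_fy i)) !expr0 subrr; apply: (ideal0 KI).
  elim: (nat_of_ord _) => [|k IH]; first by rewrite !expr0 subrr; apply: (ideal0 KI).
  by rewrite !exprS; apply: (kmul) => //; apply: (pres_inv pres).
rewrite /pairing -(subrK (\prod_G var G ^+ (enum_val i G)) (fymono i \mPo phi)) mulrDl DegD.
rewrite [X in Deg X + _]mulrC K add0r var_prod -mpolyXD DegX; apply: eq_deg => G.
by rewrite /expo mnmDE; congr addn; apply: multiK.
Qed.

(** In a linear dependency, take the index [i] of the lexicographically largest word with non-zero
    coefficient. In column [i] a non-zero entry [k] has a word at least that of [i], so only the
    diagonal entry survives, and it is not zero. *)
Lemma pairing_row_free : row_free (fymx *m pairmx).
Proof.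
apply: inj_row_free => x hx; apply/eqP; apply: contraT => /eqP nx.
have [i0 ni0] : exists i, x 0 i != 0.
  apply/existsP; apply: contra_notT nx => /existsPn h; apply/rowP => i; rewrite mxE.
  by apply/eqP; have := h i; rewrite negbK.
pose word (i : 'I_B) : seqlexi nat := [seq (enum_val i G : nat) | G <- inner L].
case: (@Order.TotalTheory.arg_maxP _ _ _ i0 (fun i => x 0 i != 0) word ni0) => i ni imax.
have /matrixP/(_ 0 i) := hx; rewrite mxE [RHS]mxE => /eqP.
have entry k : (fymx *m pairmx) k i =
    deg L (fun G => enum_val k G + dual L (fun G => enum_val i G) G)%N.
  rewrite mxE -pairing_fymono -coeffs_pairing; apply: eq_bigr => c _.
  by rewrite !mxE.
rewrite (bigD1 i) //= big1 ?addr0 => [|k nk].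
  by rewrite entry mulf_eq0 (negPf ni) (negPf (deg_dual_neq0 nontriv (fyset_fy i))).
have [->|nxk] := eqVneq (x 0 k) 0; first by rewrite mul0r.
rewrite entry; set D := deg L _; have [->|h] := eqVneq D 0; first by rewrite mulr0.
have l1 := deg_dual_lexi nontriv (fyset_fy i) h.
have l2 := imax k nxk; have ew : word k = word i by apply: le_anti; rewrite l1 andbT; apply: l2.
case/eqP: nk; apply: enum_val_inj; apply/ffunP => G; apply: val_inj.
by apply: (inner_inj (fyset_fy k) (fyset_fy i)) => //; rewrite !fyset_sum.
Qed.

(** The columns of [pairmx] lie in the kernel of [ideal_mx], and by [pairing_row_free] their rank is
    at least B. Conversely, by [span_zero], stacking the B rows of [fymx] on [ideal_mx] gives full
    column rank. *)
Theorem quot_dim_fy : quot_dim Gs j = B.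
Proof.
have lower : (\rank (ideal_mx Gs j) + B <= M)%N.
  apply: leq_trans (mulmx0_rank_max ideal_pairmx); rewrite leq_add2l.
  have /eqP e := pairing_row_free.
  by apply: leq_trans (mxrankM_maxr fymx pairmx); rewrite e.
have upper : (M <= \rank (ideal_mx Gs j) + B)%N.
  have full : row_free (col_mx (ideal_mx Gs j) fymx)^T.
    apply: inj_row_free => x hx; apply: trmx_inj; rewrite trmx0.
    have := congr1 trmx hx; rewrite trmx_mul trmxK trmx0 mul_col_mx -col_mx0.
    by case/eq_col_mx; apply: span_zero.
  have /eqP e := full; rewrite -[leqLHS]e mxrank_tr -addsmxE.
  apply: leq_trans (leq_add (leqnn _) (rank_leq_row fymx)).
  by have [] := mxrank_adds_leqif (ideal_mx Gs j) fymx.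
by rewrite /quot_dim; lia.
Qed.

End Presentation.
End DegreeMap.

(** * The lattice of flats and the two Chow rings *)

Section Flats.
Variables (E : finType) (M : matroid E).
Implicit Types (X Y F G H : {set E}).

Definition flat_closure X := [set x | M (x |: X) == M X].

Lemma mrank0 : M set0 = 0%N.
Proof. by apply/eqP; rewrite -leqn0 -(cards0 E) mrank_le_card. Qed.

Lemma mrankU1 x X : (M (x |: X) <= (M X).+1)%N.
Proof.
have := mrank_submod M [set x] X; have := mrank_le_card M [set x]; rewrite cards1; lia.
Qed.

Lemma mrankU1_sub x X Y : X \subset Y -> M (x |: X) = M X -> M (x |: Y) = M Y.
Proof.
move=> sXY e; have := mrank_submod M (x |: X) Y.
rewrite -setUA (setUidPr sXY) e.
have : (M X <= M ((x |: X) :&: Y))%N by apply: mrank_mono; rewrite subsetI subsetUr.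
by have : (M Y <= M (x |: Y))%N by [apply: mrank_mono; rewrite subsetUr]; lia.
Qed.

Lemma closure_sub X : X \subset flat_closure X.
Proof. by apply/subsetP => x xX; rewrite inE (setUidPr _) // sub1set. Qed.

Lemma mrank_closure X : M (flat_closure X) = M X.
Proof.
have aux (s : seq E) : {subset s <= flat_closure X} -> M ([set x in s] :|: X) = M X.
  elim: s => [_|x s IH h]; first by rewrite set_nil set0U.
  rewrite set_cons -setUA (@mrankU1_sub _ X) ?subsetUr //.
    by apply: IH => y ys; apply: h; rewrite inE ys orbT.
  by apply/eqP; have := h x (mem_head _ _); rewrite inE.
rewrite -[RHS](aux (enum (flat_closure X))) => [|x]; last by rewrite mem_enum.
by rewrite set_enum (setUidPl (closure_sub X)).
Qed.

Lemma flatbP F : reflect (forall x, x \notin F -> (M F < M (x |: F))%N) (flatb M F).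
Proof. by apply: (iffP forallP) => h x; [move/implyP: (h x) | apply/implyP/h]. Qed.

Lemma closure_flat X : flatb M (flat_closure X).
Proof.
apply/flatbP => x; rewrite inE mrank_closure => nx.
have le1 : (M X <= M (x |: X))%N by apply: mrank_mono; apply: subsetUr.
have le2 : (M (x |: X) <= M (x |: flat_closure X))%N by apply: mrank_mono; rewrite setUS ?closure_sub.
by apply: leq_trans le2; rewrite ltn_neqAle eq_sym nx.
Qed.

Lemma closure_min X F : flatb M F -> X \subset F -> flat_closure X \subset F.
Proof.
move=> /flatbP fF sXF; apply/subsetP => x; rewrite inE => /eqP e.
by apply: contraT => /fF; rewrite (mrankU1_sub sXF e) ltnn.
Qed.

Lemma closure_subP X F : flatb M F -> (flat_closure X \subset F) = (X \subset F).
Proof.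
move=> fF; apply/idP/idP; last exact: closure_min.
by apply: subset_trans; apply: closure_sub.
Qed.

Lemma flat_rank_lt F X : flatb M F -> F \proper X -> (M F < M X)%N.
Proof.
move=> /flatbP fF /properP[sFX [x xX /fF lt]]; apply: leq_trans lt _.
by apply: mrank_mono; rewrite subUset sub1set xX.
Qed.

Lemma flatT : flatb M setT.
Proof. by apply/flatbP => x; rewrite inE. Qed.

Definition flat := {F : {set E} | flatb M F}.

Definition flat_le (F G : flat) := val F \subset val G.
Definition flat_join (F G : flat) : flat := Sub _ (closure_flat (val F :|: val G)).

Fact flat_le_anti : antisymmetric flat_le.
Proof. by move=> x y; rewrite /flat_le -eqEsubset => /eqP/val_inj. Qed.

Fact flat_le_trans : transitive flat_le.
Proof. by move=> x y z; apply: subset_trans. Qed.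

Definition flat_bot : flat := Sub _ (closure_flat set0).
Definition flat_top : flat := Sub _ flatT.

Fact flat_le_bot (F : flat) : flat_le flat_bot F.
Proof. by rewrite /flat_le closure_subP ?sub0set ?(valP F). Qed.

Fact flat_le_join (F G H : flat) : flat_le (flat_join F G) H = flat_le F H && flat_le G H.
Proof. by rewrite /flat_le closure_subP ?subUset ?(valP H). Qed.

Fact flat_mono (F G : flat) : flat_le F G -> F != G -> (M (val F) < M (val G))%N.
Proof. by move=> l n; apply: flat_rank_lt (valP F) _; rewrite properEneq n. Qed.

Fact flat_cover (F G : flat) : flat_le F G -> F != G ->
  exists H : flat, [/\ flat_le F H, flat_le H G & M (val H) = (M (val F)).+1].
Proof.
move=> l n; have /properP[_ [x xG xF]] : val F \proper val G by rewrite properEneq n.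
exists (Sub _ (closure_flat (x |: val F))); rewrite /flat_le /=; split.
- by apply: subset_trans (closure_sub _); apply: subsetUr.
- by rewrite closure_subP ?(valP G) // subUset sub1set xG.
by apply/eqP; rewrite mrank_closure eqn_leq mrankU1; apply: (flatbP _ (valP F)).
Qed.

Fact flat_semimod (K F G : flat) : flat_le K F -> flat_le K G ->
  (M (val (flat_join F G)) + M (val K) <= M (val F) + M (val G))%N.
Proof.
move=> lF lG; rewrite /= mrank_closure; apply: leq_trans (mrank_submod _ _ _).
by rewrite leq_add2l mrank_mono // subsetI; apply/andP.
Qed.

Definition flat_lattice : smlattice flat :=
  @SMLattice flat flat_le flat_join (fun x => M (val x)) flat_bot flat_top
    (fun x => subxx _) flat_le_anti flat_le_trans flat_le_bot (fun x => subsetT _)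
    flat_le_join (etrans (mrank_closure _) mrank0) flat_mono flat_cover flat_semimod.

(* [H] is the closure of [F] together with [i]. *)
Lemma cover_subset (F H G : flat) (i : E) : covers flat_lattice F H ->
  i \in val H -> i \notin val F -> flat_le F G -> i \in val G -> flat_le H G.
Proof.
case/andP=> /= lFH /eqP r iH iF lFG iG.
pose C : flat := Sub _ (closure_flat (i |: val F)).
have lCH : flat_le C H by rewrite /flat_le closure_subP ?(valP H) // subUset sub1set iH.
have -> : H = C.
  apply/esym; apply: (@sle_eq_rk _ flat_lattice) => //=.
  by rewrite r mrank_closure; apply: (flatbP _ (valP F)).
by rewrite /flat_le closure_subP ?(valP G) // subUset sub1set iG.
Qed.

Lemma cover_closure (F : flat) (i : E) : i \notin val F ->
  covers flat_lattice F (Sub _ (closure_flat (i |: val F))).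
Proof.
move=> iF; rewrite /covers /= mrank_closure /flat_le /=.
rewrite (subset_trans (subsetUr [set i] _) (closure_sub _)) /=.
by rewrite eqn_leq mrankU1; apply: (flatbP _ (valP F)).
Qed.

End Flats.

(** * A new bottom element below a semimodular lattice *)

Section AdjoinBottom.
Variables (T : finType) (L : smlattice T).
Implicit Types (x y z : option T).

Definition ole x y : bool :=
  match x, y with None, _ => true | Some _, None => false | Some a, Some c => sle L a c end.
Definition ojoin x y : option T :=
  match x, y with None, _ => y | _, None => x | Some a, Some c => Some (sjoin L a c) end.
Definition ork x : nat := if x is Some a then (srk L a).+1 else 0%N.

Fact ole_refl : reflexive ole. Proof. by case=> //= a; apply: sle_refl. Qed.

Fact ole_anti : antisymmetric ole.
Proof. by case=> [a|] [c|] //= h; rewrite (sle_anti h). Qed.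

Fact ole_trans : transitive ole.
Proof. by case=> [a|] [c|] [e|] //=; apply: sle_trans. Qed.

Fact ole_top x : ole x (Some (stop L)).
Proof. by case: x => //= a; apply: sle_top. Qed.

Fact ole_join x y z : ole (ojoin x y) z = ole x z && ole y z.
Proof. by case: x y z => [a|] [c|] [e|] //=; rewrite ?andbT // sle_join. Qed.

Fact ork_mono x y : ole x y -> x != y -> (ork x < ork y)%N.
Proof. by case: x y => [a|] [c|] //= l n; apply: srk_mono. Qed.

Fact ork_cover x y : ole x y -> x != y ->
  exists z, [/\ ole x z, ole z y & ork z = (ork x).+1].
Proof.
case: x y => [a|] [c|] //= l n; last by exists (Some (sbot L)); rewrite /= sle_bot srk_bot.
by have [e [h1 h2 h3]] := srk_cover l n; exists (Some e); split=> //=; rewrite h3.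
Qed.

Fact ork_semimod k x y : ole k x -> ole k y -> (ork (ojoin x y) + ork k <= ork x + ork y)%N.
Proof.
case: k x y => [e|] [a|] [c|] //= h1 h2; last by rewrite addn0.
  by have := srk_semimod h1 h2; lia.
by have := srk_semimod (sle_bot L a) (sle_bot L c); lia.
Qed.

Definition adjoin_bottom : smlattice (option T) :=
  @SMLattice (option T) ole ojoin ork None (Some (stop L)) ole_refl ole_anti ole_trans
    (fun x => isT) ole_top ole_join erefl ork_mono ork_cover ork_semimod.

Lemma big_some (V : nmodType) (P : pred (option T)) (f : option T -> V) : ~~ P None ->
  \sum_(x | P x) f x = \sum_(a | P (Some a)) f (Some a).
Proof.
move=> nP; rewrite (reindex_omap Some id) /=; last by case=> // Pn; rewrite Pn in nP.
by apply: eq_bigl => a; rewrite eqxx andbT.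
Qed.

End AdjoinBottom.

Lemma mvarE n (i : 'I_n) (k : nat) : k = i -> mvar n k = 'X_i.
Proof. by move=> ->; rewrite /mvar insubT //= => h; congr 'X_(_); apply: val_inj. Qed.

(** * Presentations of the reduced and the augmented Chow ring *)

Section Loopless.
Variables (E : finType) (M : matroid E).
Hypotheses (ll : loopless M) (pos : (0 < M setT)%N).
Local Notation bt := (flat_bot M).
Local Notation tp := (flat_top M).

Lemma val_flat_bot : val bt = set0.
Proof.
apply/setP => x; rewrite !inE setU0 mrank0.
by apply/negbTE/eqP; apply: ll.
Qed.

Lemma mem_flat_bot (F : flat M) i : i \in val F -> F != bt.
Proof. by apply: contraTneq => ->; rewrite val_flat_bot inE. Qed.

Lemma bot_neq_top : bt != tp.
Proof.
by apply: contraTneq pos => /(congr1 val) /= <-; rewrite mrank_closure mrank0.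
Qed.

Lemma flat_eq_set0 (F : flat M) : (val F == set0) = (F == bt).
Proof. by rewrite -val_flat_bot (inj_eq val_inj). Qed.

Lemma flat_eq_setT (F : flat M) : (val F == setT) = (F == tp).
Proof. by rewrite -(inj_eq val_inj). Qed.

Lemma big_flats (V : nmodType) (P : pred {set E}) (f : {set E} -> V) :
  \sum_(F : {set E} | flatb M F && P F) f F = \sum_(F : flat M | P (val F)) f (val F).
Proof.
rewrite (reindex_omap val (insub : {set E} -> option (flat M))) /=; last first.
  by move=> F /andP[fF _]; rewrite insubT.
by apply: eq_bigl => F; rewrite (valP F) valK eqxx andbT.
Qed.

Section Reduced.
Variable i0 : E.
Let fl := red_flats M.
Let x (F : {set E}) : {mpoly rat[size fl]} := mvar (size fl) (index F fl).

Lemma mem_red_flats (F : flat M) : (val F \in fl) = (F != bt) && (F != tp).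
Proof.
by rewrite mem_filter mem_enum inE andbT (valP F) flat_eq_set0 flat_eq_setT.
Qed.

Lemma big_red_flats (V : nmodType) (P : pred {set E}) (f : {set E} -> V) :
  \sum_(F <- fl | P F) f F = \sum_(F : flat M | [&& F != bt, F != tp & P (val F)]) f (val F).
Proof.
rewrite big_filter_cond big_enum_cond /=.
rewrite (eq_bigl (fun F => flatb M F && [&& F != set0, F != setT & P F])); last first.
  by move=> F; rewrite -!andbA.
rewrite big_flats; apply: eq_bigl => F; by rewrite flat_eq_set0 flat_eq_setT.
Qed.

(** The value at the top is forced by the covering relation from the empty flat to the closure of
    [i0]; another choice of [i0] changes it by a linear generator. *)
Definition red_xi (F : flat M) : {mpoly rat[size fl]} :=
  if F == bt then 1 else if F == tp then - \sum_(G <- fl | i0 \in G) x G else x (val F).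

Definition red_phi : (size fl).-tuple {mpoly rat[#|{: flat M}|]} :=
  [tuple var (insubd tp (nth set0 fl i) : flat M) | i < size fl].

Lemma red_xiE (F : flat M) : F != bt -> F != tp -> red_xi F = x (val F).
Proof. by rewrite /red_xi => /negPf-> /negPf->. Qed.

Lemma red_x_comp (F : flat M) : val F \in fl -> x (val F) \mPo red_phi = var F.
Proof.
move=> h; have lt : (index (val F : {set E}) fl < size fl)%N by rewrite index_mem.
rewrite /x (@mvarE _ (Ordinal lt)) // comp_mpolyXU -tnth_nth tnth_mktuple /= nth_index //.
by rewrite valKd.
Qed.

Lemma red_sum_xi i : \sum_(G : flat M | i \in val G) red_xi G =
  \sum_(G <- fl | i \in G) x G - \sum_(G <- fl | i0 \in G) x G.
Proof.
rewrite (bigD1 tp) ?inE //= {1}/red_xi eqxx eq_sym (negPf bot_neq_top) addrC; congr (_ - _).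
rewrite big_red_flats; apply: eq_big => [G|G /andP[iG nG]].
  case: (boolP (i \in val G)) => iG; rewrite ?andbF //= ?andbT.
  by rewrite (mem_flat_bot iG).
by rewrite red_xiE // (mem_flat_bot iG).
Qed.

Lemma var_sum_through i : \sum_(G : flat M | [&& G != bt, G != tp & i \in val G]) var G + var tp =
  \sum_(G : flat M | i \in val G) xvar (flat_lattice M) G.
Proof.
rewrite [RHS](bigD1 tp) ?inE //= addrC; congr (_ + _).
  apply: eq_big => [G|G /and3P[nb _ _]]; last by rewrite /xvar (negPf nb).
  case: (boolP (i \in sval G)) => iG; rewrite ?andbF //= ?andbT.
  by rewrite (mem_flat_bot iG).
by rewrite /xvar ifN // eq_sym bot_neq_top.
Qed.

(** This is the covering relation at the bottom, where x_b = 1: the flats above the closure of [i]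
    are those containing [i]. *)
Lemma kill_through i : kill (flat_lattice M) (\sum_(G : flat M | i \in val G) xvar (flat_lattice M) G).
Proof.
have ib : i \notin val bt by rewrite val_flat_bot inE.
have := chow_cover (@chow_rel_kill _ (flat_lattice M) bot_neq_top) (cover_closure ib).
rewrite {1}/xvar eqxx mul1r; congr (kill _ _); apply: eq_bigl => G.
have e : i |: val bt = [set i] by rewrite val_flat_bot setU0.
by rewrite /= /flat_le /= closure_subP ?(valP G) // e sub1set.
Qed.

Lemma red_sum_comp i : (\sum_(F <- fl | i \in F) x F) \mPo red_phi + var tp =
  \sum_(G : flat M | i \in val G) xvar (flat_lattice M) G.
Proof.
rewrite raddf_sum /= big_red_flats -var_sum_through; congr (_ + _).
by apply: eq_bigr => H /and3P[nb nt _]; rewrite red_x_comp // mem_red_flats nb.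
Qed.

Lemma red_presentation : presentation (flat_lattice M) (red_chow_gens M) red_xi red_phi.
Proof.
have xin F : F != bt -> F != tp -> val F \in fl by move=> h1 h2; rewrite mem_red_flats h1.
have incneq F G : ~~ flat_le F G -> ~~ flat_le G F -> F != bt /\ F != tp.
  move=> h1 h2; split; first by apply: contraNneq h1 => ->; apply: flat_le_bot.
  by apply: contraNneq h2 => ->; apply: subsetT.
split.
- move=> I II gI.
  have inc F G : ~~ flat_le F G -> ~~ flat_le G F -> I (red_xi F * red_xi G).
    move=> h1 h2; have [Fb Ft] := incneq _ _ h1 h2; have [Gb Gt] := incneq _ _ h2 h1.
    rewrite !red_xiE //; apply: gI; rewrite mem_cat; apply/orP; left.
    apply/mapP; exists (val F, val G) => //; rewrite mem_filter /incomparable negb_or.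
    rewrite -/(flat_le F G) -/(flat_le G F) h1 h2 /=.
    by apply/allpairsP; exists (val F, val G); rewrite /= !xin.
  split=> //; first by rewrite /red_xi eqxx.
  move=> F H cFH; have /properP[_ [i iH iF]] : val F \proper val H.
    by have /andP[n l] := covers_lt cFH; rewrite properEneq n.
  (* For i in H but not in F, the sum over the flats through [i] is a generator. Those that do not
     contain [H] are incomparable to [F] by [cover_subset] and drop out. *)
  have : I (red_xi F * \sum_(G : flat M | i \in val G) red_xi G).
    apply: (idealMl II); rewrite red_sum_xi; apply: gI; rewrite mem_cat; apply/orP; right.
    apply/mapP; exists (i, i0) => //.
    by apply/allpairsP; exists (i, i0); rewrite !mem_enum.
  rewrite (bigID (fun G => flat_le H G)) /= => h.
  have -> : \sum_(G : flat M | flat_le H G) red_xi G = \sum_(G : flat M | (i \in val G) && flat_le H G) red_xi G.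
    apply: eq_bigl => G; apply/idP/andP => [l|[]//]; split=> //.
    by move/subsetP: l; apply.
  rewrite -[X in I X](addrK (red_xi F * \sum_(G : flat M | (i \in val G) && ~~ flat_le H G) red_xi G)).
  rewrite -mulrDr -mulN1r; apply: (idealD II) => //; apply: (idealMl II).
  rewrite mulr_sumr; apply: (ideal_sum II) => G /andP[iG nHG]; apply: inc.
    by apply: contra nHG => l; apply: (cover_subset cFH iH iF l iG).
  by apply: contra iF => /subsetP; apply.
- move=> I II gI i; have im : nth set0 fl i \in fl by rewrite mem_nth.
  have fF : flatb M (nth set0 fl i) by move: im; rewrite mem_filter => /andP[/andP[/andP[]]].
  pose F : flat M := Sub _ fF; have := im; rewrite -[nth _ _ _]/(val F) mem_red_flats => /andP[nb nt].
  exists (fun G => (G == F)%:R); split; first by rewrite eq_sym (negPf nb).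
  rewrite (bigD1 F) //= eqxx scale1r big1 ?addr0 => [|G /negPf->]; last by rewrite scale0r.
  rewrite red_xiE // /x (@mvarE _ i); last by rewrite /= index_uniq // filter_uniq ?enum_uniq.
  by rewrite subrr; apply: (ideal0 II).
- by move=> i; rewrite tnth_mktuple dhomogX /= mdeg1.
- have KI := kill_ideal (flat_lattice M); have kr := @chow_rel_kill _ (flat_lattice M) bot_neq_top.
  have flatof F : F \in fl -> exists G : flat M, F = val G.
    by rewrite mem_filter => /andP[/andP[/andP[fF _] _] _]; exists (Sub _ fF).
  move=> g; rewrite mem_cat => /orP[] /mapP[[F G]].
    rewrite mem_filter => /andP[+ /allpairsP[[F' G'] /= [+ + [eF eG]]]] ->.
    rewrite eF eG {F G eF eG} /incomparable negb_or => + F'l G'l.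
    have [F eF] := flatof _ F'l; have [G eG] := flatof _ G'l; rewrite {}eF {}eG in F'l G'l *.
    case/andP=> h1 h2; rewrite rmorphM /= !red_x_comp //.
    have := chow_incomp kr h1 h2; rewrite /xvar.
    by have [/negPf-> _] := incneq _ _ h1 h2; have [/negPf-> _] := incneq _ _ h2 h1.
  move=> _ -> /=; set i := F; set i' := G.
  rewrite comp_mpolyB -[X in X - _](addrK (var tp)) -[X in _ - X](addrK (var tp)) !red_sum_comp.
  rewrite opprB addrA subrK -mulN1r.
  by apply: (idealD KI); [|apply: (idealMl KI)]; apply: kill_through.
move=> F nb; have KI := kill_ideal (flat_lattice M).
have [->|nt] := eqVneq F tp; last by rewrite red_xiE // red_x_comp ?xin // subrr; apply: (ideal0 KI).
rewrite /red_xi eq_sym (negPf bot_neq_top) eqxx comp_mpolyN -opprD red_sum_comp.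
by rewrite -mulN1r; apply: (idealMl KI); apply: kill_through.
Qed.

Theorem red_hilb_fy j : red_hilb M j = #|fyset (flat_lattice M) j|.
Proof. exact: (@quot_dim_fy _ (flat_lattice M) bot_neq_top _ _ _ _ red_presentation). Qed.

End Reduced.
Section Augmented.
Let fl := aug_flats M.
Local Notation N := (size fl + #|E|)%N.
Let x (F : {set E}) : {mpoly rat[N]} := mvar N (index F fl).
Let y (i : E) : {mpoly rat[N]} := mvar N (size fl + enum_rank i).
Local Notation L := (adjoin_bottom (flat_lattice M)).

Lemma mem_aug_flats (F : flat M) : (val F \in fl) = (F != tp).
Proof. by rewrite mem_filter mem_enum inE andbT (valP F) flat_eq_setT. Qed.

Lemma big_aug_flats (V : nmodType) (P : pred {set E}) (f : {set E} -> V) :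
  \sum_(F <- fl | P F) f F = \sum_(F : flat M | (F != tp) && P (val F)) f (val F).
Proof.
rewrite big_filter_cond big_enum_cond /=.
rewrite (eq_bigl (fun F => flatb M F && ((F != setT) && P F))); last first.
  by move=> F; rewrite -!andbA.
by rewrite big_flats; apply: eq_bigl => F; rewrite flat_eq_setT.
Qed.

(** The relation for the cover of [None] says that all x_F sum to zero, which determines the value
    at the top. *)
Definition aug_xi (o : option (flat M)) : {mpoly rat[N]} :=
  if o is Some F then if F == tp then - \sum_(G <- fl) x G else x (val F) else 1.

(** Since all x_F with the top included sum to zero, y_i, the sum over the flats missing i, is minus
    the sum over the flats through i. *)
Definition aug_phi : N.-tuple {mpoly rat[#|{: option (flat M)}|]} :=
  [tuple match split i with
         | inl k => var (Some (insubd tp (nth set0 fl k) : flat M))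
         | inr k => - \sum_(F : flat M | enum_val k \in val F) var (Some F)
         end | i < N].

Lemma aug_xiE (F : flat M) : F != tp -> aug_xi (Some F) = x (val F).
Proof. by move=> /negPf /= ->. Qed.

Lemma aug_x_comp (F : flat M) : F != tp -> x (val F) \mPo aug_phi = var (Some F).
Proof.
rewrite -mem_aug_flats => h.
have lt : (index (val F : {set E}) fl < size fl)%N by rewrite index_mem.
rewrite /x (@mvarE _ (lshift #|E| (Ordinal lt))) // comp_mpolyXU -tnth_nth tnth_mktuple.
by rewrite (unsplitK (inl _)) /= nth_index // valKd.
Qed.

Lemma aug_y_comp i :
  y i \mPo aug_phi = - \sum_(F : flat M | i \in val F) var (Some F).
Proof.
rewrite /y (@mvarE _ (rshift (size fl) (enum_rank i))) // comp_mpolyXU -tnth_nth tnth_mktuple.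
by rewrite (unsplitK (inr _)) enum_rankK.
Qed.

Lemma aug_sum_comp (P : pred {set E}) : (\sum_(F <- fl | P F) x F) \mPo aug_phi =
  \sum_(F : flat M | (F != tp) && P (val F)) var (Some F).
Proof.
rewrite raddf_sum /= big_aug_flats.
by apply: eq_bigr => F /andP[nt _]; rewrite aug_x_comp.
Qed.

Lemma sum_aug_xi : \sum_(F : flat M) aug_xi (Some F) = 0.
Proof.
rewrite (bigD1 tp) //= eqxx (big_aug_flats xpredT) addrC; apply/eqP; rewrite subr_eq0.
by apply/eqP; apply: eq_big => [F|F /negPf->]; rewrite ?andbT.
Qed.

Lemma kill_all : kill L (\sum_(F : flat M) var (Some F)).
Proof.
have cN : covers L None (Some bt) by rewrite /covers /= mrank_closure mrank0.
have := chow_cover (@chow_rel_kill _ L isT) cN.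
rewrite /xvar /= mul1r big_some //=; congr (kill _ _).
by apply: eq_bigl => F; rewrite flat_le_bot.
Qed.

Lemma aug_incneq (F G : flat M) : ~~ flat_le F G -> ~~ flat_le G F -> G != tp.
Proof. by move=> h _; apply: contraNneq h => ->; apply: subsetT. Qed.

Lemma aug_presentation : presentation L (aug_chow_gens M) aug_xi aug_phi.
Proof.
have KI := kill_ideal L; have kr := @chow_rel_kill _ L isT.
have flatof F : F \in fl -> exists2 G : flat M, F = val G & G != tp.
  move=> Fl; have := Fl; rewrite mem_filter => /andP[/andP[fF _] _].
  by exists (Sub _ fF); rewrite // -mem_aug_flats.
split.
- move=> I II gI.
  have gy i : I (y i - \sum_(F <- fl | i \notin F) x F).
    by apply: gI; rewrite mem_cat; apply/orP; left; apply: map_f; rewrite mem_enum.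
  have gxx (F G : flat M) : ~~ flat_le F G -> ~~ flat_le G F -> I (x (val F) * x (val G)).
    move=> h1 h2; apply: gI; rewrite !mem_cat; apply/orP; right; apply/orP; left.
    apply/mapP; exists (val F, val G) => //; rewrite mem_filter /incomparable negb_or.
    rewrite -/(flat_le F G) -/(flat_le G F) h1 h2 /=.
    by apply/allpairsP; exists (val F, val G); rewrite /= !mem_aug_flats (aug_incneq h1 h2) (aug_incneq h2 h1).
  have gyx i (F : flat M) : F != tp -> i \notin val F -> I (y i * x (val F)).
    move=> nt iF; apply: gI; rewrite !mem_cat; apply/orP; right; apply/orP; right.
    apply/mapP; exists (i, val F) => //; rewrite mem_filter iF /=.
    by apply/allpairsP; exists (i, val F); rewrite /= mem_enum mem_aug_flats.
  have inc (F G : flat M) : ~~ flat_le F G -> ~~ flat_le G F -> I (aug_xi (Some F) * aug_xi (Some G)).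
    move=> h1 h2; rewrite !aug_xiE ?(aug_incneq h1 h2) ?(aug_incneq h2 h1) //; exact: gxx.
  split=> // [[F|] [G|] //|[F|] [H|] //]; first exact: inc.
    rewrite /covers /= eqSS => cFH; have {}cFH : covers (flat_lattice M) F H by [].
    rewrite big_some //.
    change (I (aug_xi (Some F) * \sum_(G : flat M | flat_le H G) aug_xi (Some G))).
    have /andP[nFH lFH] := covers_lt cFH.
    have /properP[_ [i iH iF]] : val F \proper val H by rewrite properEneq nFH.
    have nt : F != tp by apply: contraNneq iF => ->; rewrite inE.
    (* Up to sign the sum is y_i modulo the ideal, and y_i x_F is a generator because [i] is not in
       [F]. *)
    have hi : I (aug_xi (Some F) * \sum_(G : flat M | i \in val G) aug_xi (Some G)).
      have -> : \sum_(G : flat M | i \in val G) aug_xi (Some G) =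
          (y i - \sum_(F <- fl | i \notin F) x F) - y i.
        have e : \sum_(G : flat M | i \in val G) aug_xi (Some G) =
            - \sum_(G : flat M | i \notin val G) aug_xi (Some G).
          by apply/eqP; rewrite -addr_eq0; apply/eqP; rewrite -[RHS]sum_aug_xi [RHS](bigID (fun G : flat M => i \in val G)).
        rewrite e addrAC subrr add0r big_aug_flats; congr (- _).
        apply: eq_big => [G|G iG]; last by rewrite aug_xiE //; apply: contraNneq iG => ->; rewrite inE.
        case: (boolP (i \in val G)) => iG; rewrite ?andbF // andbT; apply/esym.
        by apply: contraNneq iG => ->; rewrite inE.
      rewrite mulrBr; apply: (idealD II); first exact: (idealMl II).
      by rewrite -mulN1r; apply: (idealMl II); rewrite aug_xiE // mulrC; apply: gyx.
    rewrite (bigID (fun G => flat_le H G)) in hi.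
    have -> : \sum_(G : flat M | flat_le H G) aug_xi (Some G) =
              \sum_(G : flat M | (i \in val G) && flat_le H G) aug_xi (Some G).
      apply: eq_bigl => G; apply/idP/andP => [l|[]//]; split=> //.
      by move/subsetP: l; apply.
    rewrite -[X in I X](addrK (aug_xi (Some F) * \sum_(G : flat M | (i \in val G) && ~~ flat_le H G) aug_xi (Some G))).
    rewrite -mulrDr -mulN1r; apply: (idealD II) => //; apply: (idealMl II).
    rewrite mulr_sumr; apply: (ideal_sum II) => G /andP[iG nHG]; apply: inc.
      by apply: contra nHG => l; apply: (cover_subset cFH iH iF l iG).
    by apply: contra iF => /subsetP; apply.
  rewrite /covers /= eqSS => /eqP r0; rewrite big_some //=.
  have eH : H = bt.
    by apply/esym; apply: (@sle_eq_rk _ (flat_lattice M)); [apply: flat_le_bot | rewrite /= r0].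
  rewrite mul1r (eq_bigl xpredT) => [|F]; last by rewrite eH flat_le_bot.
  by rewrite sum_aug_xi; apply: (ideal0 II).
- move=> I II gI i.
  have [[k|k] ->] : exists s, i = unsplit s by exists (split i); rewrite splitK.
    have im : nth set0 fl k \in fl by rewrite mem_nth.
    have [F eF nt] := flatof _ im.
    exists (fun G => (G == Some F)%:R); split=> //.
    rewrite (bigD1 (Some F)) // eqxx scale1r big1 ?addr0 => [|G /negPf nG]; last by rewrite nG scale0r.
    rewrite /=.
    rewrite (negPf nt) -eF /x (@mvarE _ (lshift _ k)) ?addr0 ?subrr; first exact: (ideal0 II).
    by rewrite index_uniq // filter_uniq ?enum_uniq.
  pose e : E := enum_val k.
  exists (fun o : option (flat M) => if o is Some F then (e \notin val F)%:R else 0); split=> //.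
  rewrite (bigD1 None) //= scale0r add0r.
  rewrite big_some //= (eq_bigr (fun F : flat M => if e \notin val F then aug_xi (Some F) else 0)).
    rewrite -big_mkcond /= (eq_bigl (fun F : flat M => (F != tp) && (e \notin val F))).
      rewrite (eq_bigr (fun F : flat M => x (val F))) => [|F /andP[nt _]]; last exact: aug_xiE.
      rewrite -(big_aug_flats (fun F => e \notin F)) -(@mvarE _ _ (size fl + enum_rank e)); last by rewrite enum_valK.
      by apply: gI; rewrite mem_cat; apply/orP; left; apply: map_f; rewrite mem_enum.
    by move=> F; have [->|_] := eqVneq F tp; rewrite /= ?inE.
  by move=> F _; case: (e \in val F); rewrite ?scale0r ?scale1r.
- move=> i; rewrite tnth_mktuple; case: (split i) => k; first by rewrite dhomogX /= mdeg1.
  by rewrite rpredN; apply: rpred_sum => F _; rewrite dhomogX /= mdeg1.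
- move=> g; rewrite !mem_cat => /or3P[] /mapP[].
  + move=> i _ ->; rewrite comp_mpolyB aug_y_comp (aug_sum_comp (fun F => i \notin F)).
    rewrite [X in _ - X](eq_bigl (fun F : flat M => i \notin val F)); last first.
      by move=> F; have [->|_] := eqVneq F tp; rewrite /= ?inE.
    rewrite -opprD -mulN1r; apply: (idealMl KI).
    by have := kill_all; rewrite (bigID (fun F : flat M => i \in val F)).
  + move=> [F G]; rewrite mem_filter => /andP[+ /allpairsP[[F' G'] /= [+ + [eF eG]]]] ->.
    rewrite eF eG {F G eF eG} /incomparable negb_or => + F'l G'l.
    have [F eF tF] := flatof _ F'l; have [G eG tG] := flatof _ G'l.
    rewrite {}eF {}eG; case/andP=> h1 h2; rewrite rmorphM /= !aug_x_comp //.
    exact: (chow_incomp kr (F := Some F) (G := Some G)).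
  move=> [i F]; rewrite mem_filter => /andP[+ /allpairsP[[i' F'] /= [_ + [ei eF]]]] ->.
  rewrite ei eF {i F ei eF} => + F'l; have [F eF tF] := flatof _ F'l; rewrite {}eF => /= iF.
  rewrite rmorphM /= aug_x_comp // aug_y_comp mulNr -mulN1r; apply: (idealMl KI).
  have cFH := cover_closure iF; set H := (X in covers _ _ X) in cFH.
  have cFH' : covers L (Some F) (Some H) by rewrite /covers /= eqSS.
  have iH : i' \in val H by rewrite (subsetP (closure_sub M _)) // !inE eqxx.
  rewrite mulrC (bigID (fun G => flat_le H G)) /= mulrDr; apply: (idealD KI).
    have := chow_cover kr cFH'; rewrite big_some //=; congr (kill _ (_ * _)).
    apply: eq_bigl => G; apply/idP/andP => [l|[]//]; split=> //.
    by move/subsetP: l; apply.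
  rewrite mulr_sumr; apply: (ideal_sum KI) => G /andP[iG nHG].
  apply: (chow_incomp kr (F := Some F) (G := Some G)) => /=.
    by apply: contra nHG => l; apply: (cover_subset cFH iH iF l iG).
  by apply: contra iF => /subsetP; apply.
move=> [F|] // _.
have [->|nt] := eqVneq F tp; last by rewrite aug_xiE // aug_x_comp ?subrr //; apply: (ideal0 KI).
rewrite /= eqxx comp_mpolyN (aug_sum_comp xpredT) -opprD -mulN1r; apply: (idealMl KI).
have := kill_all; rewrite (bigD1 tp) //= addrC; congr (kill _ (_ + _)).
by apply: eq_bigl => F'; rewrite andbT.
Qed.

Theorem aug_hilb_fy j : aug_hilb M j = #|fyset L j|.
Proof. exact: (@quot_dim_fy _ L isT _ _ _ _ aug_presentation). Qed.

End Augmented.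
End Loopless.

(** * Counting Feichtner--Yuzvinsky monomials *)

Section GenericFY.
Variables (X : finType) (le : rel X) (rho : X -> nat) (D : pred X) (o : option X) (j : nat).

Definition gbelow (m : X -> nat) K := \max_(F | ((F != K) && le F K) && (0 < m F)%N) rho F.

(* FY monomials supported in [D]; when [o = Some H], those involving [H]. *)
Definition gfy (m : X -> nat) :=
  [forall K, (0 < m K)%N ==> [&& D K, (m K + gbelow m K < rho K)%N &
     [forall F, (0 < m F)%N ==> le F K || le K F]]].

Definition gset : {set {ffun X -> 'I_j.+1}} :=
  [set u : {ffun X -> 'I_j.+1} | [&& gfy (fun x => u x), (\sum_x u x)%N == j &
     (if o is Some H then 0 < u H else true)%N]].

Lemma gfyP (m : X -> nat) K : gfy m -> (0 < m K)%N ->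
  [/\ D K, (m K + gbelow m K < rho K)%N & forall F, (0 < m F)%N -> le F K || le K F].
Proof.
move=> /forallP/(_ K)/implyP h /h /and3P[h1 h2 /forallP h3]; split=> // F.
by move/implyP: (h3 F).
Qed.

End GenericFY.

Section Transport.
Variables (X Y : finType) (leX : rel X) (leY : rel Y) (rX : X -> nat) (rY : Y -> nat).
Variables (DX : pred X) (DY : pred Y) (oX : option X) (j : nat).

(** An isomorphism of the possible supports only; elsewhere the maps are arbitrary. This allows
    flats, optional flats and plain sets to be compared. *)
Record matching (h : X -> Y) (g : Y -> X) : Prop := Matching {
  match_dom : forall x, DX x -> DY (h x) && (g (h x) == x);
  match_cod : forall y, DY y -> DX (g y) && (h (g y) == y);
  match_le : forall x x', DX x -> DX x' -> leY (h x) (h x') = leX x x';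
  match_rk : forall x, DX x -> rY (h x) = rX x
}.

Variables (h : X -> Y) (g : Y -> X).
Hypothesis hg : matching h g.
Hypothesis oD : if oX is Some H then DX H else true.

Let push (u : {ffun X -> 'I_j.+1}) : {ffun Y -> 'I_j.+1} :=
  [ffun y => if DY y then u (g y) else ord0].

Lemma push_h u x : DX x -> push u (h x) = u x.
Proof. by move=> /(match_dom hg)/andP[dy /eqP e]; rewrite ffunE dy e. Qed.

Lemma push_supp u y : (0 < push u y)%N -> exists x, [/\ DX x, y = h x & (0 < u x)%N].
Proof.
rewrite ffunE; case: ifP => // /(match_cod hg)/andP[dx /eqP e] p.
by exists (g y).
Qed.

Lemma gset_push u : u \in gset leX rX DX oX j -> push u \in gset leY rY DY (omap h oX) j.
Proof.
rewrite !inE => /and3P[f /eqP su ou]; apply/and3P; split.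
- apply/forallP => K; apply/implyP => /push_supp[x [dx eK ux]].
  have [_ lt ch] := gfyP f ux; have /andP[dK _] := match_dom hg dx.
  rewrite {1}eK dK eK push_h // (match_rk hg) //=; apply/andP; split.
    apply: leq_ltn_trans lt; rewrite leq_add2l; apply/bigmax_leqP => F /andP[/andP[nF lF]].
    case/push_supp=> x' [dx' eF ux']; rewrite eF (match_rk hg) //.
    apply: (@leq_bigmax_cond _ _ rX); rewrite ux' andbT -(match_le hg) // -eF lF andbT.
    by apply: contraNneq nF => e; rewrite eF e.
  apply/forallP => F; apply/implyP => /push_supp[x' [dx' -> ux']].
  by rewrite !(match_le hg) // ch.
- apply/eqP; rewrite -[RHS]su (bigID DY) /= [X in (_ + X)%N]big1 ?addn0; last first.
    by move=> y /negPf n; rewrite ffunE n.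
  rewrite (reindex_onto h g) => [|y /(match_cod hg)/andP[_ /eqP //]].
  rewrite [RHS](bigID DX) /= [X in (_ + X)%N]big1 ?addn0; last first.
    by move=> x; case: (posnP (u x)) => // /(gfyP f)[-> //].
  apply: eq_big => [x|x /andP[dy /eqP e]]; last by rewrite ffunE dy e.
  apply/andP/idP => [[/(match_cod hg)/andP[d1 _] /eqP <- //]|dx].
  by apply/andP/(match_dom hg).
by case: (oX) oD ou => //= H dH uH; rewrite push_h.
Qed.

Lemma gset_card_le : (#|gset leX rX DX oX j| <= #|gset leY rY DY (omap h oX) j|)%N.
Proof.
rewrite -(card_in_imset (f := push) (D := mem (gset leX rX DX oX j))).
  by apply: subset_leq_card; apply/subsetP => v /imsetP[u ui ->]; apply: gset_push.
move=> u v; rewrite !inE => /and3P[fu _ _] /and3P[fv _ _] e; apply/ffunP => x.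
have [dx|ndx] := boolP (DX x); first by rewrite -!push_h // e.
have Z (w : {ffun X -> 'I_j.+1}) : gfy leX rX DX (fun x => w x) -> w x = ord0.
  move=> fw; apply: val_inj; apply/eqP; rewrite -leqn0 leqNgt; apply: contra ndx.
  by case/(gfyP fw).
by rewrite !Z.
Qed.

End Transport.

Lemma matching_sym (X Y : finType) (leX : rel X) (leY : rel Y) rX rY DX DY h g :
  matching leX leY rX rY DX DY h g -> matching leY leX rY rX DY DX g h.
Proof.
move=> m; split=> [y|x|y y' d d'|y d]; [exact: match_cod m _|exact: match_dom m _| |].
  have /andP[d1 /eqP e1] := match_cod m d; have /andP[d2 /eqP e2] := match_cod m d'.
  by rewrite -(match_le m) // e1 e2.
by have /andP[d1 /eqP e1] := match_cod m d; rewrite -(match_rk m) // e1.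
Qed.

Lemma gset_card (X Y : finType) (leX : rel X) (leY : rel Y) rX rY (DX : pred X) (DY : pred Y) h g oX j :
  matching leX leY rX rY DX DY h g -> (if oX is Some H then DX H else true) ->
  #|gset leX rX DX oX j| = #|gset leY rY DY (omap h oX) j|.
Proof.
move=> m oD; apply/eqP; rewrite eqn_leq (gset_card_le j m oD) /=.
have [e oD'] : omap g (omap h oX) = oX /\ is_true (if omap h oX is Some H then DY H else true).
  by case: (oX) oD => //= H /(match_dom m)/andP[-> /eqP ->].
by have := gset_card_le j (matching_sym m) oD'; rewrite e.
Qed.

Lemma eq_gset (X : finType) (le : rel X) rho rho' (D D' : pred X) o j :
  (forall u, u \in gset le rho D o j -> forall K, (0 < u K)%N -> D' K) ->
  (forall K, D' K -> (0 < rho' K)%N -> D K) -> (forall K, D' K -> rho' K = rho K) ->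
  gset le rho D o j = gset le rho' D' o j.
Proof.
move=> h1 h2 h3; apply/setP => u; have := h1 u; rewrite !inE.
have R m : (forall K, (0 < m K)%N -> D' K) ->
    forall K, gbelow le rho' m K = gbelow le rho m K.
  move=> hm K; apply: eq_bigr => F /andP[_ /hm dF]; exact: h3.
move=> {}h1; apply/and3P/and3P => [[f s p]|[f s p]]; split=> //.
  have hD := h1 _; move: hD; rewrite f s p => /(_ isT) hD.
  apply/forallP => K; apply/implyP => uK; have [dK lt ch] := gfyP f uK.
  rewrite hD // R // h3 ?hD // lt /=; apply/forallP => F; apply/implyP; exact: ch.
apply/forallP => K; apply/implyP => uK; have [dK lt ch] := gfyP f uK.
have hD F : (0 < u F)%N -> D' F by case/(gfyP f).
rewrite h2 //=; last by apply: leq_ltn_trans lt.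
rewrite -h3 // -R // lt; apply/forallP => F; apply/implyP; exact: ch.
Qed.

(* The case [s = 0] counts reduced, [s = 1] augmented FY monomials. *)
Section SetLevel.
Variables (E : finType) (M : matroid E) (s j : nat).

Definition fyM := #|gset (fun F G : {set E} => F \subset G) (fun F => M F + s)%N (flatb M) None j|.

End SetLevel.

Lemma fyset_gset (T : finType) (L : smlattice T) j :
  fyset L j = gset (sle L) (srk L) predT None j.
Proof.
apply/setP => u; rewrite !inE andbT; congr andb; apply: eq_forallb => K.
Qed.

Section HilbFY.
Variables (E : finType) (M : matroid E).
Hypotheses (ll : loopless M) (pos : (0 < M setT)%N).

Lemma red_hilb_fyM (i0 : E) j : red_hilb M j = fyM M 0 j.
Proof.
rewrite (red_hilb_fy ll pos i0) fyset_gset.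
apply: (@gset_card _ _ _ _ _ _ _ _ val (insubd (flat_top M))) => //; split=> //.
- by move=> F _; rewrite valKd eqxx andbT (valP F).
- by move=> F fF; rewrite insubdK //= eqxx.
- by move=> F _; rewrite addn0.
Qed.

(** [None] has rank 0 and carries no exponent. What remains of it is the shift of all ranks by one,
    as an empty chain below still counts as rank 0. *)
Lemma aug_hilb_fyM j : aug_hilb M j = fyM M 1 j.
Proof.
rewrite aug_hilb_fy fyset_gset (@eq_gset _ _ _ (srk (adjoin_bottom (flat_lattice M))) _ isSome) //=.
  pose h (o : option (flat M)) : {set E} := if o is Some F then val F else set0.
  pose g (F : {set E}) : option (flat M) := Some (insubd (flat_top M) F).
  apply: (@gset_card _ _ _ _ _ _ _ _ h g) => //; split.
  - by move=> [F|] // _; rewrite /g /h valKd eqxx andbT (valP F).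
  - by move=> F fF; rewrite /= insubdK //= eqxx.
  - by move=> [F|] [G|].
  - by move=> [F|] //= _; rewrite addn1.
by move=> u; rewrite inE => /and3P[f _ _] [F|] // /(gfyP f)[].
Qed.

End HilbFY.

Definition setle (E : finType) : rel {set E} := fun F G => F \subset G.

(* Monomials on the lattice of all subsets of [A] with fewer than [q] elements, topped by [A]
   in rank [a]; [z] requires the exponent of [A] to be positive. *)
Section Standard.
Variables (E : finType) (A : {set E}) (q a s : nat) (z : bool) (j : nat).

Definition stdD (K : {set E}) := (K == A) || (#|K| < q)%N && (K \subset A).
Definition stdrk (K : {set E}) := ((if K == A then a else #|K|) + s)%N.
Definition stdcount := #|gset (@setle E) stdrk stdD (if z then Some A else None) j|.

End Standard.

Lemma stdcount_card (E E' : finType) (A : {set E}) (A' : {set E'}) q a s z j :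
  E -> E' -> #|A| = #|A'| -> stdcount A q a s z j = stdcount A' q a s z j.
Proof.
move=> x0 y0 cA.
pose f x := nth y0 (enum A') (index x (enum A)).
pose g y := nth x0 (enum A) (index y (enum A')).
have idx x : x \in A -> (index x (enum A) < size (enum A'))%N.
  by move=> xA; rewrite -cardE -cA cardE index_mem mem_enum.
have idy y : y \in A' -> (index y (enum A') < size (enum A))%N.
  by move=> yA; rewrite -cardE cA cardE index_mem mem_enum.
have fA x : x \in A -> f x \in A' by move=> xA; rewrite -mem_enum mem_nth ?idx.
have gA y : y \in A' -> g y \in A by move=> yA; rewrite -mem_enum mem_nth ?idy.
have gf x : x \in A -> g (f x) = x.
  by move=> xA; rewrite /g /f index_uniq ?enum_uniq ?idx // nth_index ?mem_enum.
have fg y : y \in A' -> f (g y) = y.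
  by move=> yA; rewrite /g /f index_uniq ?enum_uniq ?idy // nth_index ?mem_enum.
have sub (K : {set E}) : K \subset A -> f @: K \subset A'.
  by move=> /subsetP sK; apply/subsetP => y /imsetP[x xK ->]; apply/fA/sK.
have sub' (K : {set E'}) : K \subset A' -> g @: K \subset A.
  by move=> /subsetP sK; apply/subsetP => y /imsetP[x xK ->]; apply/gA/sK.
have gfK (K : {set E}) : K \subset A -> g @: (f @: K) = K.
  move=> /subsetP sK; rewrite -imset_comp -[RHS]imset_id; apply: eq_in_imset => x /sK xA.
  exact: gf.
have fgK (K : {set E'}) : K \subset A' -> f @: (g @: K) = K.
  move=> /subsetP sK; rewrite -imset_comp -[RHS]imset_id; apply: eq_in_imset => x /sK xA.
  exact: fg.
have cK (K : {set E}) : K \subset A -> #|f @: K| = #|K|.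
  by move=> /subsetP sK; apply: card_in_imset => x y /sK xA /sK yA e; rewrite -(gf x) // e gf.
have cK' (K : {set E'}) : K \subset A' -> #|g @: K| = #|K|.
  by move=> /subsetP sK; apply: card_in_imset => x y /sK xA /sK yA e; rewrite -(fg x) // e fg.
have fAA : f @: A = A' by apply/eqP; rewrite eqEcard sub // cK // cA leqnn.
have gAA : g @: A' = A by rewrite -fAA gfK.
have eA (K : {set E}) : K \subset A -> (f @: K == A') = (K == A).
  by move=> sK; apply/eqP/eqP => [e|->//]; rewrite -(gfK K) // e.
have eA' (K : {set E'}) : K \subset A' -> (g @: K == A) = (K == A').
  by move=> sK; apply/eqP/eqP => [e|->//]; rewrite -(fgK K) // e.
have D1 (K : {set E}) : stdD A q K -> K \subset A by case/orP => [/eqP->//|/andP[]].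
have D2 (K : {set E'}) : stdD A' q K -> K \subset A' by case/orP => [/eqP->//|/andP[]].
rewrite /stdcount (@gset_card _ _ _ (@setle E') _ (stdrk A' a s) _ (stdD A' q)
  (fun K : {set E} => f @: K) (fun K : {set E'} => g @: K)).
- by case: z => //=; rewrite fAA.
- split=> [K dK|K dK|K K' /D1 sK /D1 sK'|K /D1 sK].
  + by have sK := D1 _ dK; rewrite gfK // eqxx andbT /stdD eA // cK // sub // -[X in _ && X](sK).
  + by have sK := D2 _ dK; rewrite fgK // eqxx andbT /stdD eA' // cK' // sub' // -[X in _ && X](sK).
  + apply/idP/idP => [h|]; last exact: imsetS.
    by rewrite -(gfK K) // -(gfK K') //; apply: imsetS.
  + by rewrite /stdrk eA // cK.
by case: z => //=; rewrite /stdD eqxx.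
Qed.

(** The model on m points sits inside ['I_m.+1], which is inhabited even for m = 0: [stdcount_card]
    needs default elements. *)
Definition sc m q a s z j := stdcount [set i : 'I_m.+1 | (i < m)%N] q a s z j.

Lemma stdcountE (E : finType) (A : {set E}) q a s z j :
  E -> stdcount A q a s z j = sc #|A| q a s z j.
Proof.
move=> x0; apply: stdcount_card => //; first exact: ord0.
rewrite -sum1dep_card big_mkcond big_ord_recr /= ltnn addn0.
by under eq_bigr => i _ do rewrite ltn_ord; rewrite sum1_card card_ord.
Qed.

(** * Flats of paving matroids and the split of the count by hyperplanes *)

Section Paving.
Variables (E : finType) (M : matroid E).
Hypotheses (pv : paving M) (pos : (0 < M setT)%N).
Implicit Types (X K H : {set E}).
Local Notation k := (M setT).

(** A dependent set contains a minimal dependent set, which is a circuit and so has at least k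
    elements. *)
Lemma paving_indep X : (#|X| < k)%N -> M X = #|X|.
Proof.
move=> lt; apply/eqP; apply: contraTT lt => nX; rewrite -leqNgt.
have [C /minsetP[nC minC] sCX] := minset_exists (P := fun Y => ~~ indepb M Y) nX.
apply: leq_trans (subset_leq_card sCX); apply: pv; rewrite /circuitb nC /=.
apply/forallP => Y; apply/implyP => pY; apply: contraT => nY.
by have eY := minC _ nY (proper_sub pY); rewrite eY properxx in pY.
Qed.

Lemma small_flat K : (#|K| < k.-1)%N -> flatb M K.
Proof.
move=> lt; apply/flatbP => x xK.
have c : #|x |: K| = #|K|.+1 by rewrite cardsU1 xK.
have e1 : M K = #|K| by apply: paving_indep; lia.
have e2 : M (x |: K) = #|x |: K| by apply: paving_indep; lia.
by rewrite e1 e2 c.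
Qed.

Lemma subset_card_exists K m : (m <= #|K|)%N -> exists2 X : {set E}, X \subset K & #|X| = m.
Proof.
move=> le; have : (0 < #|[set X : {set E} | (X \subset K) && (#|X| == m)]|)%N.
  by rewrite cards_draws bin_gt0.
by case/card_gt0P => X; rewrite inE => /andP[sX /eqP cX]; exists X.
Qed.

Lemma flat_small K : (M K < k.-1)%N -> (#|K| < k.-1)%N.
Proof.
move=> lt; rewrite ltnNge; apply/negP => /subset_card_exists[X sX cX].
by have := mrank_mono M sX; rewrite paving_indep cX //; lia.
Qed.

Lemma flat_rank_top K : flatb M K -> (k <= M K)%N -> K = setT.
Proof.
move=> fK; apply: contraTeq => nT; rewrite -ltnNge; apply: flat_rank_lt => //.
by rewrite properT.
Qed.

Local Notation hyp := (hyperplaneb M).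

Lemma hyp_rank H : hyp H -> M H = k.-1. Proof. by case/andP=> _ /eqP. Qed.

Lemma hyp_card H : hyp H -> (k.-1 <= #|H|)%N.
Proof. by move/hyp_rank <-; apply: mrank_le_card. Qed.

Section Decompose.
Variables (s j : nat).
Local Notation rho := (fun F : {set E} => M F + s)%N.

(** Distinct hyperplanes are flats of equal rank, hence incomparable, and a chain holds at most
    one. *)
Lemma fyM_split : fyM M s j = (#|gset (@setle E) rho [pred F | flatb M F & ~~ hyp F] None j|
  + \sum_(H | hyp H) #|gset (@setle E) rho (flatb M) (Some H) j|)%N.
Proof.
rewrite /fyM -/(setle (E := E)); set S := gset _ _ _ None j.
have -> : #|gset (@setle E) rho [pred F | flatb M F & ~~ hyp F] None j| =
   (\sum_(u in S) [forall H, hyp H ==> (u H == ord0)])%N.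
  rewrite -sum1_card big_mkcond [RHS]big_mkcond /=; apply: eq_bigr => u _.
  have -> : (u \in gset (@setle E) rho [pred F | flatb M F & ~~ hyp F] None j) =
     (u \in S) && [forall H, hyp H ==> (u H == ord0)].
    rewrite !inE !andbT andbAC; congr andb.
    apply/idP/andP => [f|[f /forallP n]].
      split; apply/forallP => K; apply/implyP.
        by case/(gfyP f)=> /andP[h1 _] h2 h3; rewrite h1 h2 /=; apply/forallP => F; apply/implyP/h3.
      apply: contraTT => nu; have uK : (0 < u K)%N by rewrite lt0n.
      by case/(gfyP f): uK => /andP[_ ].
    apply/forallP => K; apply/implyP => uK; case/(gfyP f): (uK) => h1 h2 h3.
    rewrite /= h1 h2 /=; apply/andP; split; last by apply/forallP => F; apply/implyP/h3.
    by apply: contraTN uK => hK; have /implyP/(_ hK)/eqP-> := n K.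
  by case: (u \in S) => //=; case: [forall _, _].
have -> : (\sum_(H | hyp H) #|gset (@setle E) rho (flatb M) (Some H) j| =
   \sum_(u in S) \sum_(H | hyp H) (0 < u H))%N.
  rewrite exchange_big /=; apply: eq_bigr => H _.
  rewrite -sum1_card big_mkcond [RHS]big_mkcond /=; apply: eq_bigr => u _.
  rewrite !inE andbT; case: (gfy _ _ _ _) => //=; case: (_ == j) => //=.
rewrite -big_split /= -sum1_card; apply: eq_bigr => u uS.
have f : gfy (@setle E) rho (flatb M) (fun x => u x) by move: uS; rewrite inE => /andP[].
case: (boolP [forall _, _]) => [/forallP h|].
  rewrite big1 // => H hH; have /implyP/(_ hH)/eqP -> := h H; by [].
rewrite negb_forall => /existsP[H]; rewrite negb_imply => /andP[hH nu].
have uH : (0 < u H)%N by rewrite lt0n.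
rewrite (bigD1 H) //= uH big1 // => H' /andP[hH' nH].
apply/eqP; rewrite eqb0; apply/negP => uH'.
have [_ _ /(_ _ uH) ch] := gfyP f uH'; have fl G : hyp G -> flatb M G by case/andP.
case/orP: ch => sub; case/eqP: nH; apply/eqP; apply: contraT => ne.
  have /(flat_rank_lt (fl _ hH)) : H \proper H' by rewrite properEneq eq_sym ne.
  by rewrite (hyp_rank hH) (hyp_rank hH') ltnn.
have /(flat_rank_lt (fl _ hH')) : H' \proper H by rewrite properEneq ne.
by rewrite (hyp_rank hH) (hyp_rank hH') ltnn.
Qed.

Lemma stdD_top_rank K : stdD setT k.-1 K -> stdrk setT k s K = (M K + s)%N.
Proof.
rewrite /stdD /stdrk; case: eqP => [->//|_] /= /andP[lt _].
by rewrite paving_indep //; lia.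
Qed.

(** Apart from [setT], the flats that are not hyperplanes are exactly the sets with fewer than k - 1
    elements. *)
Lemma stdcount_top : #|gset (@setle E) rho [pred F | flatb M F & ~~ hyp F] None j| =
  stdcount [set: E] k.-1 k s false j.
Proof.
rewrite /stdcount; congr #|pred_of_set _|; apply: eq_gset.
- move=> u; rewrite inE => /and3P[f _ _] K /(gfyP f)[/andP[/= fK nh] _ _].
  rewrite /stdD subsetT andbT; case: (leqP k (M K)) => [/(flat_rank_top fK)->|lt].
    by rewrite eqxx.
  rewrite flat_small ?orbT //; move: nh; rewrite /hyperplaneb fK /=; lia.
- move=> K dK _; rewrite /= /hyperplaneb; case/orP: dK => [/eqP->|/andP[lt _]].
    by rewrite flatT /=; lia.
  by rewrite small_flat //= paving_indep; lia.
exact: stdD_top_rank.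
Qed.

Lemma stdcount_hyp H : hyp H ->
  #|gset (@setle E) rho (flatb M) (Some H) j| = stdcount H k.-1 k.-1 s true j.
Proof.
move=> hH; have rH := hyp_rank hH; have /andP[fH _] := hH.
rewrite /stdcount; congr #|pred_of_set _|; apply: eq_gset.
- move=> u; rewrite inE => /and3P[f _ uH] K uK; have [fK lt ch] := gfyP f uK.
  rewrite /stdD; case: eqVneq => //= nKH.
  have [sKH|nsKH] := boolP (K \subset H).
    by rewrite andbT flat_small // -rH flat_rank_lt // properEneq nKH.
  (* Above [H] the rank rises by at most one, which leaves no positive exponent for [K]. *)
  have sHK : H \subset K by move: (ch _ uH); rewrite /setle (negPf nsKH) orbF.
  have : (M H + s <= gbelow (@setle E) rho (fun x => u x) K)%N.
    by apply: (@leq_bigmax_cond _ _ rho); rewrite uH eq_sym nKH /setle sHK.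
  by have := mrank_mono M (subsetT K); move: lt uK; rewrite rH /=; lia.
- by move=> K /orP[/eqP->//|/andP[lt _] _]; apply: small_flat.
move=> K; rewrite /stdD /stdrk; case: eqP => [->|_ /andP[lt _]]; first by rewrite rH.
by rewrite paving_indep //; lia.
Qed.

Lemma fyM_paving (x0 : E) : fyM M s j = (sc #|E| k.-1 k s false j +
  \sum_(H | hyp H) sc #|H| k.-1 k.-1 s true j)%N.
Proof.
rewrite fyM_split stdcount_top stdcountE // cardsT; congr addn.
by apply: eq_bigr => H hH; rewrite stdcount_hyp // stdcountE.
Qed.

End Decompose.

Lemma sum_bin_hyp : (\sum_(H | hyp H) 'C(#|H|, k.-1) = 'C(#|E|, k.-1))%N.
Proof.
rewrite -cardsT -cards_draws -sum1_card.
under eq_bigr => H _ do rewrite -cards_draws -sum1_card big_mkcond /=.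
rewrite exchange_big [RHS]big_mkcond /=; apply: eq_bigr => X _.
rewrite inE subsetT /=; case: (boolP (#|X| == k.-1)) => [/eqP cX|nX]; last first.
  by rewrite big1 // => H _; rewrite inE (negPf nX) andbF.
have rX : M X = k.-1 by rewrite paving_indep cX //; lia.
have hC : hyp (flat_closure M X) by rewrite /hyperplaneb closure_flat mrank_closure rX eqxx.
rewrite (bigD1 (flat_closure M X)) //= inE closure_sub cX eqxx big1 // => H /andP[hH nH].
rewrite inE cX eqxx andbT; case: ifP => // sXH; case/eqP: nH.
have /andP[fH _] := hH; apply/esym/eqP; apply: contraT => ne.
have /(flat_rank_lt (closure_flat M X)) : flat_closure M X \proper H.
  by rewrite properEneq ne closure_min.
by rewrite mrank_closure rX (hyp_rank hH) ltnn.
Qed.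

(** Sets of at most k - 1 elements are independent, so the restriction is uniform. The contraction
    has rank 1, and it has no loops because [H] is a flat. *)
Lemma hyp_stressed H : hyp H -> stressedb M H.
Proof.
move=> hH; have /andP[/flatbP fH _] := hH; have rH := hyp_rank hH.
apply/andP; split; apply/forallP => X; apply/implyP => sX; apply/implyP => le.
  by apply/eqP/paving_indep; rewrite rH in le; lia.
have {}le : (#|X| <= 1)%N by move: le; rewrite rH; lia.
have [X0|] := posnP #|X|.
  by rewrite X0 (cards0_eq X0) set0U subnn.
move=> X0; have /cards1P[x eX] : #|X| == 1%N by rewrite eqn_leq le.
rewrite eX in sX *; rewrite cards1; have xH : x \notin H by move: sX; rewrite sub1set inE.
have := fH x xH; have := mrank_mono M (subsetT (x |: H)); rewrite rH => h1 h2.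
by apply/eqP; lia.
Qed.

End Paving.

(** The excess of a hyperplane of size h over 'C(h, k-1) hyperplanes of size k - 1, one for each of
    its (k-1)-subsets. It vanishes at h = k - 1, and [base_fy] counts as if all hyperplanes had that
    size. *)
Definition stressed_coef k s j h : int :=
  (sc h k.-1 k.-1 s true j)%:Z - 'C(h, k.-1)%:Z * (sc k.-1 k.-1 k.-1 s true j)%:Z.

Definition base_fy k s j n : int :=
  (sc n k.-1 k s false j)%:Z + 'C(n, k.-1)%:Z * (sc k.-1 k.-1 k.-1 s true j)%:Z.

Theorem fyM_stressed (E : finType) (M : matroid E) k s j : paving M -> M setT = k -> (0 < k)%N ->
  (fyM M s j)%:Z = base_fy k s j #|E| +
    \sum_(k <= h < #|E|.+1) (num_stressed_hyp M h)%:Z * stressed_coef k s j h.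
Proof.
move=> pv rk pos; rewrite -rk in pos *.
have [x0 _] : exists x : E, true.
  apply/existsP; apply: contraTT pos; rewrite negb_exists => /forallP h.
  by rewrite (_ : setT = set0) ?mrank0 //; apply/setP => x; have := h x.
rewrite (fyM_paving pv pos s j x0) PoszD /base_fy -addrA; congr (_ + _).
rewrite -(sum_bin_hyp pv pos) !(big_morph Posz PoszD (erefl _)) mulr_suml.
have -> : \sum_(M setT <= h < #|E|.+1) (num_stressed_hyp M h)%:Z * stressed_coef (M setT) s j h =
   \sum_(H | hyperplaneb M H) stressed_coef (M setT) s j #|H|.
  under eq_bigr => h _.
    rewrite /num_stressed_hyp -sum1_card (big_morph Posz PoszD (erefl _)) mulr_suml big_mkcond /=.
    over.
  rewrite exchange_big [RHS]big_mkcond /=; apply: eq_bigr => H _.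
  case: (boolP (hyperplaneb M H)) => hH; last first.
    by rewrite big1 // => h _; rewrite inE (negPf hH).
  transitivity (\sum_(M setT <= h < #|E|.+1 | h == #|H|) stressed_coef (M setT) s j h).
    rewrite [RHS]big_mkcond; apply: eq_bigr => h _.
    by rewrite inE hH (hyp_stressed pv pos hH) /= eq_sym mul1r.
  (* Hyperplanes of size k - 1 fall outside the range of summation, but their coefficient is 0. *)
  rewrite big_nat1_eq ltnS max_card andbT; case: leqP => // lt.
  have e : #|H| = (M setT).-1 by apply/eqP; rewrite eqn_leq hyp_card // andbT; lia.
  by rewrite /stressed_coef e binn mul1r subrr.
by rewrite -big_split /=; apply: eq_bigr => H _; rewrite /stressed_coef addrC subrK.
Qed.

(** * Uniform matroids and direct sums *)

Section Uniform.
Variables (a b : nat).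

Fact urank_le_card X : (urank a b X <= #|X|)%N. Proof. exact: geq_minl. Qed.

Fact urank_mono (X Y : {set 'I_b}) : X \subset Y -> (urank a b X <= urank a b Y)%N.
Proof. by move=> /subset_leq_card le; rewrite /urank; lia. Qed.

Fact urank_submod X Y :
  (urank a b (X :|: Y) + urank a b (X :&: Y) <= urank a b X + urank a b Y)%N.
Proof.
have := cardsUI X Y; have := subset_leq_card (subsetIl X Y).
by have := subset_leq_card (subsetIr X Y); rewrite /urank; lia.
Qed.

Definition uniform : matroid 'I_b := Matroid urank_le_card urank_mono urank_submod.

Lemma uniform_loopless : (0 < a)%N -> loopless uniform.
Proof. by move=> pa x; rewrite /= /urank cards1; lia. Qed.

Lemma uniform_rank : (a <= b)%N -> uniform setT = a.
Proof. by rewrite /= /urank cardsT card_ord; lia. Qed.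

Lemma uniform_paving : paving uniform.
Proof.
move=> C /andP[nC _]; apply: leq_trans (geq_minr _ _) _; rewrite leqNgt.
by apply: contra nC; rewrite /indepb /= /urank => lt; apply/eqP/minn_idPl/ltnW.
Qed.

Lemma uniform_hyp h : (0 < a <= b)%N -> (a <= h)%N -> num_stressed_hyp uniform h = 0%N.
Proof.
move=> /andP[pa le] lh; apply/eqP; rewrite cards_eq0; apply/eqP/setP => X.
rewrite !inE; apply/negP => /andP[/andP[/andP[_ /eqP rX] _] /eqP cX].
by move: rX; rewrite uniform_rank //= /urank cX; lia.
Qed.

End Uniform.

Section DirectSum.
Variables (E1 E2 : finType) (M1 : matroid E1) (M2 : matroid E2).
Implicit Types X Y : {set (E1 + E2)%type}.

Definition lpart X := [set x | inl x \in X].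
Definition rpart X := [set y | inr y \in X].

Lemma card_parts X : #|X| = (#|lpart X| + #|rpart X|)%N.
Proof.
rewrite -sum1_card big_sumType /= !sum1_card; congr addn; apply: eq_card => x;
  by rewrite inE.
Qed.

Lemma lpart_mono X Y : X \subset Y -> lpart X \subset lpart Y.
Proof. by move=> /subsetP s; apply/subsetP => x; rewrite !inE; apply: s. Qed.

Lemma rpart_mono X Y : X \subset Y -> rpart X \subset rpart Y.
Proof. by move=> /subsetP s; apply/subsetP => x; rewrite !inE; apply: s. Qed.

Fact dsum_le_card X : (dsum_rank M1 M2 X <= #|X|)%N.
Proof. by rewrite card_parts leq_add // mrank_le_card. Qed.

Fact dsum_mono X Y : X \subset Y -> (dsum_rank M1 M2 X <= dsum_rank M1 M2 Y)%N.
Proof. by move=> s; apply: leq_add; apply: mrank_mono; [apply: lpart_mono | apply: rpart_mono]. Qed.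

Fact dsum_submod X Y : (dsum_rank M1 M2 (X :|: Y) + dsum_rank M1 M2 (X :&: Y) <=
  dsum_rank M1 M2 X + dsum_rank M1 M2 Y)%N.
Proof.
have h1 := mrank_submod M1 (lpart X) (lpart Y).
have h2 := mrank_submod M2 (rpart X) (rpart Y).
rewrite /dsum_rank -/(lpart X) -/(lpart Y) -/(rpart X) -/(rpart Y).
have -> : [set x | inl x \in X :|: Y] = lpart X :|: lpart Y by apply/setP => x; rewrite !inE.
have -> : [set x | inl x \in X :&: Y] = lpart X :&: lpart Y by apply/setP => x; rewrite !inE.
have -> : [set x | inr x \in X :|: Y] = rpart X :|: rpart Y by apply/setP => x; rewrite !inE.
have -> : [set x | inr x \in X :&: Y] = rpart X :&: rpart Y by apply/setP => x; rewrite !inE.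
by rewrite addnACA [leqRHS]addnACA leq_add.
Qed.

Definition dsum : matroid (E1 + E2)%type := Matroid dsum_le_card dsum_mono dsum_submod.

End DirectSum.

Section OneBigHyperplane.
Variables (k h : nat).
Hypotheses (k2 : (1 < k)%N) (kh : (k <= h)%N).
Implicit Types X : {set ('I_h + 'I_1)%type}.

Local Notation D := (dsum (uniform k.-1 h) (uniform 1 1)).

Lemma rpart_le1 X : (#|rpart X| <= 1)%N.
Proof. by rewrite -[leqRHS](card_ord 1) max_card. Qed.

Lemma dsumE X : D X = (minn #|lpart X| k.-1 + #|rpart X|)%N.
Proof.
by rewrite /= /dsum_rank -/(lpart X) -/(rpart X) /urank; congr addn; apply/minn_idPl/rpart_le1.
Qed.

Lemma dsumP X : exists l r, [/\ D X = (minn l k.-1 + r)%N, #|X| = (l + r)%N,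
  #|rpart X| = r & (r <= 1)%N].
Proof.
exists #|lpart X|, #|rpart X|; split=> //; [exact: dsumE|exact: card_parts|exact: rpart_le1].
Qed.

Lemma dsum_loopless : loopless D.
Proof.
by move=> x; have [l [r [-> + _ r1]]] := dsumP [set x]; rewrite cards1; lia.
Qed.

Lemma dsum_top : D setT = k.
Proof.
rewrite dsumE.
have -> : lpart [set: 'I_h + 'I_1] = setT by apply/setP => x; rewrite !inE.
have -> : rpart [set: 'I_h + 'I_1] = setT by apply/setP => x; rewrite !inE.
by rewrite !cardsT !card_ord; lia.
Qed.

Lemma dsum_paving : paving D.
Proof.
move=> C /andP[nC _]; rewrite dsum_top leqNgt; apply: contra nC => lt.
by have [l [r [eD eC _ r1]]] := dsumP C; rewrite /indepb eD eC; apply/eqP; rewrite eC in lt; lia.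
Qed.

Definition left_side : {set ('I_h + 'I_1)%type} := [set z | if z is inl _ then true else false].

Lemma lpart_left : lpart left_side = setT. Proof. by apply/setP => x; rewrite !inE. Qed.
Lemma rpart_left : rpart left_side = set0. Proof. by apply/setP => x; rewrite !inE. Qed.

Lemma card_left : #|left_side| = h.
Proof. by rewrite card_parts lpart_left rpart_left cardsT card_ord cards0 addn0. Qed.

Lemma left_hyp : hyperplaneb D left_side.
Proof.
have rl : D left_side = k.-1.
  by rewrite dsumE lpart_left rpart_left cardsT card_ord cards0; lia.
rewrite /hyperplaneb dsum_top rl eqxx andbT; apply/flatbP => -[x|y]; rewrite ?inE // => _.
rewrite rl (_ : inr y |: left_side = setT) ?dsum_top; first by lia.
by apply/setP => -[x|y']; rewrite !inE // (ord1 y) (ord1 y') eqxx.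
Qed.

(** With the right point, rank k - 1 would leave at most k - 2 left points, too few for size k.
    Without it, at least k - 1 left points span the whole left side. *)
Lemma big_hyp_left X : hyperplaneb D X -> (k <= #|X|)%N -> X = left_side.
Proof.
case/andP=> /flatbP fX /eqP; rewrite dsum_top => rX cX.
have r0 : #|rpart X| = 0%N.
  by have [l [r [eD eX -> r1]]] := dsumP X; rewrite eD in rX; rewrite eX in cX; lia.
have le : (k.-1 <= #|lpart X|)%N.
  by apply: leq_trans (leq_pred k) _; move: cX; rewrite card_parts r0 addn0.
apply/setP => -[x|y]; rewrite !inE; last by have := cards0_eq r0 => /setP/(_ y); rewrite !inE.
apply: contraT => /fX; rewrite rX dsumE.
have -> : rpart (inl x |: X) = rpart X by apply/setP => y; rewrite !inE.
by rewrite r0 addn0 ltnNge geq_minr.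
Qed.

Lemma dsum_num_hyp m : (k <= m)%N -> num_stressed_hyp D m = (m == h).
Proof.
move=> km; rewrite /num_stressed_hyp; case: (m =P h) => [->|nm] /=.
  apply/eqP/cards1P; exists left_side; apply/setP => X; rewrite !inE.
  apply/andP/eqP => [[/andP[hX _] /eqP cX]|->]; first by apply: big_hyp_left; rewrite ?cX.
  rewrite left_hyp card_left eqxx (hyp_stressed dsum_paving) ?dsum_top ?left_hyp //; lia.
apply/eqP; rewrite cards_eq0; apply/eqP/setP => X; rewrite !inE.
apply/negP => /andP[/andP[hX _] /eqP cX]; apply: nm.
by rewrite -cX (big_hyp_left hX) ?card_left ?cX.
Qed.

End OneBigHyperplane.

Lemma fyM_uniform k n s j : (0 < k <= n)%N ->
  (fyM (uniform k n) s j)%:Z = base_fy k s j n.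
Proof.
move=> /[dup] kn /andP[pk lkn].
rewrite (fyM_stressed s j (@uniform_paving k n) (uniform_rank lkn) pk) card_ord.
by rewrite big_nat_cond big1 ?addr0 // => h /andP[/andP[le _] _]; rewrite uniform_hyp ?mul0r.
Qed.

Lemma fyM_dsum k h s j : (1 < k)%N -> (k <= h)%N ->
  (fyM (dsum (uniform k.-1 h) (uniform 1 1)) s j)%:Z =
  base_fy k s j h.+1 + stressed_coef k s j h.
Proof.
move=> k2 kh; rewrite (fyM_stressed s j (dsum_paving k2 kh) (dsum_top k2 kh)); last by lia.
rewrite card_sum !card_ord addn1; congr (_ + _).
rewrite (eq_big_nat _ _ (F2 := fun m => if m == h then stressed_coef k s j m else 0)).
  by rewrite -big_mkcond /= big_nat1_eq ifT //; lia.
move=> m /andP[km _]; rewrite (dsum_num_hyp k2 kh km).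
by case: eqP => _; rewrite ?mul1r ?mul0r.
Qed.

(** * The rank one case and the final formula *)

Lemma num_stressed_hyp_rank1 (E : finType) (M : matroid E) h :
  loopless M -> M setT = 1%N -> (0 < h)%N -> num_stressed_hyp M h = 0%N.
Proof.
move=> ll r1 hp; apply/eqP; rewrite cards_eq0; apply/eqP/setP => X; rewrite !inE.
apply/negP => /andP[/andP[/andP[_ /eqP rX] _] /eqP cX].
move: hp; rewrite -cX card_gt0 => /set0Pn[x xX]; case: (ll x); apply/eqP.
by rewrite -leqn0 -[leqRHS](_ : M X = 0%N) ?mrank_mono ?sub1set // rX r1.
Qed.

(** [fyM_stressed] on the two model matroids on h + 1 elements gives the same base term, so for k >
    1 their difference is minus [stressed_coef]. For k = 1 all multiplicities are 0: the only
    hyperplane is the empty flat. *)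
Lemma paving_formula (E : finType) (M : matroid E) (k n s j : nat) :
  loopless M -> paving M -> M setT = k -> (1 <= k)%N -> #|E| = n ->
  (fyM M s j)%:Z = (fyM (uniform k n) s j)%:Z -
    \sum_(k <= h < n.+1) (num_stressed_hyp M h)%:Z *
      ((fyM (uniform k h.+1) s j)%:Z -
       (fyM (dsum (uniform k.-1 h) (uniform 1 1)) s j)%:Z).
Proof.
move=> ll pv rk pos cE; have kn : (k <= n)%N by rewrite -rk -cE -cardsT mrank_le_card.
rewrite (fyM_stressed s j pv rk pos) cE fyM_uniform ?pos //; congr (_ + _).
rewrite -sumrN; apply: eq_big_nat => h /andP[kh _].
have [k1|k1] := leqP k 1.
  have e : k = 1%N by apply/eqP; rewrite eqn_leq k1.
  by rewrite (num_stressed_hyp_rank1 (h := h) ll) ?mul0r ?oppr0 ?rk //; lia.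
rewrite fyM_uniform ?fyM_dsum //; last by lia.
by rewrite opprD addrA subrr sub0r mulrN opprK.
Qed.

Theorem theorem1p12 (E : finType) (M : matroid E) (k n : nat) :
  loopless M -> paving M -> M setT = k -> (1 <= k)%N -> #|E| = n ->
  forall j : nat,
    ((red_hilb M j)%:Z =
       (red_hilb (urank k n) j)%:Z
       - \sum_(k <= h < n.+1)
           (num_stressed_hyp M h)%:Z *
           ((red_hilb (urank k h.+1) j)%:Z
            - (red_hilb (dsum_rank (urank k.-1 h) (urank 1 1)) j)%:Z))
    /\
    ((aug_hilb M j)%:Z =
       (aug_hilb (urank k n) j)%:Z
       - \sum_(k <= h < n.+1)
           (num_stressed_hyp M h)%:Z *
           ((aug_hilb (urank k h.+1) j)%:Z
            - (aug_hilb (dsum_rank (urank k.-1 h) (urank 1 1)) j)%:Z)).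
Proof.
move=> ll pv rk pos cE j; have kn : (k <= n)%N by rewrite -rk -cE -cardsT mrank_le_card.
have redU m : (k <= m)%N -> red_hilb (urank k m) j = fyM (uniform k m) 0 j.
  move=> km; have m0 : (0 < m)%N := leq_trans pos km.
  apply: (@red_hilb_fyM _ (uniform k m) _ _ (Ordinal m0)); first exact: uniform_loopless.
  by rewrite uniform_rank.
split.
  have [x0 _] : exists x : E, true.
    apply/existsP; apply: contraTT pos; rewrite negb_exists -rk -eqn0Ngt => /forallP h.
    by rewrite (_ : setT = set0) ?mrank0 //; apply/setP => x; have := h x.
  rewrite (@red_hilb_fyM _ M) ?rk // (paving_formula 0 j ll pv rk pos cE) (redU n kn).
  congr (_ - _); apply: eq_big_nat => h /andP[kh _].
  (* For k = 1 the direct sum has loops and its reduced Hilbert function is not covered by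
     [red_hilb_fyM]; its multiplicity is 0. *)
  have [k1|k1] := leqP k 1.
    have e : k = 1%N by apply/eqP; rewrite eqn_leq k1.
    by rewrite (num_stressed_hyp_rank1 (h := h) ll) ?mul0r ?rk //; lia.
  rewrite redU; last exact: leqW.
  congr (_ * (_ - Posz _)); apply/esym.
  apply: (@red_hilb_fyM _ (dsum (uniform k.-1 h) (uniform 1 1))); last exact: (inr ord0).
    exact: dsum_loopless.
  by rewrite dsum_top.
rewrite (@aug_hilb_fyM _ M) (paving_formula 1 j ll pv rk pos cE).
rewrite -(@aug_hilb_fyM _ (uniform k n)); congr (_ - _).
apply: eq_bigr => h _; rewrite -(@aug_hilb_fyM _ (uniform k h.+1)).
by rewrite -(@aug_hilb_fyM _ (dsum (uniform k.-1 h) (uniform 1 1))).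
Qed.
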